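(* Let $s>0$ and let $f:[-1,1]\to\mathbb{R}$ be of class $X^s$. Then: (i) the error of $n$-point Clenshaw--Curtis quadrature satisfies $E_n^C(f)=O(n^{-s-1})$ as $n\to\infty$; (ii) if $s\geq 2$, the error of $n$-point Gauss quadrature satisfies $E_n^G(f)=O(n^{-s-1})$ as $n\to\infty$; (iii) if $0<s<2$, the error of $n$-point Gauss quadrature satisfies $E_n^G(f)=O(n^{-3s/2})$ as $n\to\infty$.
   Context: $T_m$ denotes the Chebyshev polynomial of the first kind of degree $m$, i.e. $T_m(\cos\theta)=\cos(m\theta)$. For $s>0$, a function $f:[-1,1]\to\mathbb{R}$ is said to be of class $X^s$ if it has a Chebyshev expansion $f(x)=\tfrac12 a_0+\sum_{m=1}^{\infty}a_m T_m(x)$ for $x\in[-1,1]$ whose real coefficients satisfy $a_m=O(m^{-s-1})$ as $m\to\infty$. The coefficients are given by $a_m=\frac{2}{\pi}\int_0^\pi f(\cos\theta)\cos(m\theta)\,d\theta$. Let $I(f)=\int_{-1}^1 f(x)\,dx$. For an $n$-point quadrature rule $I_n(f)=\sum_{k=1}^n w_k f(x_k)$ on $[-1,1]$, the quadrature error is $E_n(f)=I(f)-I_n(f)$. $n$-point Clenshaw--Curtis quadrature ($n\geq 2$) is the interpolatory quadrature rule with nodes $x_k=\cos\left(\frac{k-1}{n-1}\pi\right)$, $k=1,\ldots,n$, that is, the unique rule with these nodes that is exact for all polynomials of degree at most $n-1$; its error is denoted $E_n^C(f)$. $n$-point Gauss quadrature is the Gauss--Legendre rule on $[-1,1]$, i.e.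 the interpolatory quadrature rule whose nodes are the $n$ zeros of the Legendre polynomial of degree $n$; its error is denoted $E_n^G(f)$. The constants implied in the $O$-terms may depend on $f$ and $s$ but not on $n$. *)

(* Defs.v *)
From mathcomp Require Import all_boot all_order all_algebra.
From mathcomp Require Import all_classical all_reals all_analysis.
From mathcomp Require Import ring.

Set Implicit Arguments.
Unset Strict Implicit.
Unset Printing Implicit Defensive.

Import Order.TTheory GRing.Theory Num.Theory.
Import numFieldNormedType.Exports.

Local Open Scope classical_set_scope.
Local Open Scope ring_scope.

Fixpoint chebyshevT (R : realType) (m : nat) : {poly R} :=
  match m with
  | 0 => 1
  | 1 => 'X
  | (k.+1 as m').+1 => 2 *: ('X * chebyshevT R m') - chebyshevT R k
  end.

Lemma chebyshevT_cos (R : realType) (m : nat) (t : R) :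
  (chebyshevT R m).[cos t] = cos (m%:R * t).
Proof.
suff [] : (chebyshevT R m).[cos t] = cos (m%:R * t) /\
          (chebyshevT R m.+1).[cos t] = cos (m.+1%:R * t) by [].
elim: m => [|m [IH0 IH1]]; first by rewrite /= hornerC hornerX mul0r cos0 mul1r.
split=> //.
rewrite -[chebyshevT R m.+2]/(2 *: ('X * chebyshevT R m.+1) - chebyshevT R m).
rewrite hornerD hornerN hornerZ mulrC hornerM hornerX IH0 IH1.
have -> : m.+2%:R * t = m.+1%:R * t + t by rewrite -(natr1 m.+1); ring.
have -> : m%:R * t = m.+1%:R * t - t by rewrite -(natr1 m); ring.
by rewrite cosB cosD; ring.
Qed.

(* Only the values of f on [-1, 1] are constrained. *)
Definition class_X (R : realType) (s : R) (f : R -> R) : Prop :=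
  exists a : R^nat,
    (forall x : R, -1 <= x <= 1 ->
       (fun n : nat => a 0%N / 2 + \sum_(1 <= m < n) a m * (chebyshevT R m).[x])
         @ \oo --> f x) /\
    a =O_\oo (fun m : nat => m%:R `^ (- s - 1)).

Definition quad_error (R : realType) (n : nat) (x w : 'I_n -> R) (f : R -> R)
    : R :=
  \int[@lebesgue_measure R]_(t in `[-1, 1]) f t - \sum_(k < n) w k * f (x k).

(* Recall that [size p <= n] means that p has degree at most n - 1. *)
Definition interpolatory (R : realType) (n : nat) (x w : 'I_n -> R) : Prop :=
  forall p : {poly R}, (size p <= n)%N -> quad_error x w (horner p) = 0.

(* The nodes are indexed from 0, so that k stands for the usual k - 1. *)
Definition clenshaw_curtis (R : realType) (n : nat) (x w : 'I_n -> R) : Prop :=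
  (forall k : 'I_n, x k = cos (k%:R / n.-1%:R * pi)) /\ interpolatory x w.

(* Rodrigues' formula *)
Definition legendre (R : realType) (n : nat) : {poly R} :=
  (2 ^+ n * n`!%:R)^-1 *: (('X^2 - 1) ^+ n)^`(n).

(* Since [legendre R n] has degree n, n distinct zeros are all of its zeros. *)
Definition gauss (R : realType) (n : nat) (x w : 'I_n -> R) : Prop :=
  [/\ injective x, forall k : 'I_n, root (legendre R n) (x k)
    & interpolatory x w].

(* Main.v *)
Require Import Defs.
From mathcomp Require Import all_boot all_order all_algebra.
From mathcomp Require Import all_classical all_reals all_analysis.
From mathcomp Require Import measurable_realfun.
From mathcomp Require Import ring lra zify.

Set Implicit Arguments.
Unset Strict Implicit.
Unset Printing Implicit Defensive.

Import Order.TTheory GRing.Theory Num.Theory.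
Import numFieldNormedType.Exports.

Local Open Scope classical_set_scope.
Local Open Scope ring_scope.

(* Since E_n(f) = sum_(m >= n) a_m E_n(T_m), everything rests on aliasing.  At
   the Clenshaw--Curtis nodes T_m agrees with T_r, where r is the distance of m
   to the nearest multiple of 2(n - 1), so that E_n(T_m) = I(T_m) - I(T_r) is
   O(1 / (1 + r^2)).  For Gauss quadrature with nodes cos t_k the same holds with
   the period 4n + 2, up to an error j * sum_k w_k |cos((2n + 1) t_k)| for
   m = j(4n + 2) +- r.

   That sum is O(1/n).  Put u(t) = sqrt(sin t) P_n(cos t) and N = n + 1/2; then
   u'' + (N^2 + 1/(4 sin^2 t)) u = 0, and Sonin's monotone functions bound |u|
   and |u'| in terms of their values at pi/2.  Integrating the derivative of
   u' cos psi + N u sin psi, psi = N t - pi/4, from pi/2 to t_k bounds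
   |cos psi(t_k)|, hence |cos((2n + 1) t_k)|, by O(1 / (n sin t_k)), while
   w_k = 2 / ((1 - x_k^2) P_n'(x_k)^2) = O(sin t_k / n).

   Hence |E_n(T_m)| <= C (1 / (1 + r^2) + min(1, m / n^2)), and replacing
   min(1, t) by t^al with al = min(s / 2, 1) gives the two Gauss rates
   n^(-s-al). *)

(** * Integration of polynomials over [-1, 1] through primitives *)

Section PolynomialIntegral.
Context {R : realType}.
Implicit Types p q P : {poly R}.

Definition pint p : R := \int[@lebesgue_measure R]_(t in `[-1, 1]) p.[t].

Lemma exists_primitive p : exists P, P^`() = p.
Proof.
exists (\poly_(i < (size p).+1) (p`_i.-1 / i%:R)).
apply/polyP => i; rewrite coef_deriv coef_poly ltnS.
case: ltnP => [_|le_p]; last by rewrite mul0rn nth_default.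
by rewrite -[LHS]mulr_natr divfK// pnatr_eq0.
Qed.

Lemma pint_deriv P : pint P^`() = P.[1] - P.[-1].
Proof.
rewrite /pint /Rintegral (@continuous_FTC2 _ _ (horner P)) //.
- by apply: continuous_subspaceT => x; exact: continuous_horner.
- split=> [x _||].
  + exact: derivable_horner.
  + exact: cvg_at_right_filter (@continuous_horner _ P (-1)).
  + exact: cvg_at_left_filter (@continuous_horner _ P 1).
- by move=> x _; rewrite derivE.
Qed.

Lemma pintD p q : pint (p + q) = pint p + pint q.
Proof.
have [P <-] := exists_primitive p; have [Q <-] := exists_primitive q.
by rewrite -derivD !pint_deriv !hornerD; ring.
Qed.

Lemma pintZ c p : pint (c *: p) = c * pint p.
Proof.
have [P <-] := exists_primitive p.
by rewrite -derivZ !pint_deriv !hornerZ; ring.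
Qed.

Lemma pintN p : pint (- p) = - pint p.
Proof. by rewrite -scaleN1r pintZ mulN1r. Qed.

Lemma pint_parts p q :
  pint (p^`() * q) = (p * q).[1] - (p * q).[-1] - pint (p * q^`()).
Proof. by rewrite -pint_deriv derivM pintD addrK. Qed.

(** A primitive [P] is nondecreasing on [-1, 1]; if its endpoint values agreed, it would be constant
    there, hence constant as a polynomial. *)
Lemma pint_gt0 p : p != 0 -> (forall x, -1 <= x <= 1 -> 0 <= p.[x]) ->
  0 < pint p.
Proof.
have [P <-] := exists_primitive p => p0 ge0.
have nd x y : -1 <= x -> x <= y -> y <= 1 -> P.[x] <= P.[y].
  apply: ger0_derive1_ndecr => [z _|z|].
  - exact: derivable_horner.
  - rewrite in_itv/= => /andP[z1 z2].
    by rewrite -derivE ge0// !ltW.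
  - by apply: continuous_subspaceT => z; exact: continuous_horner.
rewrite pint_deriv subr_gt0 lt_neqAle nd ?andbT; [|lra..].
apply: contra p0 => /eqP P1.
suff -> : P = P.[1]%:P by rewrite derivC.
apply/eqP; rewrite -subr_eq0; apply/negPn/negP => nz.
(* The points [1 / (i + 1)] lie in (0, 1] and there is one too many of them for a nonzero
   polynomial. *)
pose s := [seq (i.+1%:R^-1 : R) | i <- iota 0 (size (P - P.[1]%:P))].
suff : (size s < size (P - P.[1]%:P)%R)%N by rewrite size_map size_iota ltnn.
apply: max_poly_roots => //; last first.
  rewrite map_inj_uniq ?iota_uniq// => i j /invr_inj/eqP.
  by rewrite eqr_nat => /eqP[].
apply/allP => x /mapP[i _ ->]; rewrite /root !hornerE subr_eq0.
have i0 : (0 : R) < i.+1%:R^-1 by rewrite invr_gt0 ltr0Sn.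
have i1 : (i.+1%:R^-1 : R) <= 1 by rewrite invf_le1 ?ler1n ?ltr0Sn.
move: i0 i1; move: (_^-1) => y i0 i1.
apply/eqP/le_anti/andP; split; first by apply: nd; lra.
by rewrite -P1; apply: nd; lra.
Qed.

End PolynomialIntegral.

(** * Rodrigues' formula, Legendre's equation and orthogonality *)

Section Legendre.
Context {R : realType}.
Implicit Types p q : {poly R}.

(** Each derivative lowers the multiplicity of the root [a] by one, so a value at [a] survives only
    for [m = 0]. This gives both the vanishing of low derivatives at -1 and 1 and the value
    [legendre1]. *)
Lemma derivn_XsubCn (a : R) (k m : nat) q :
  ((('X - a%:P) ^+ (k + m) * q)^`(k)).[a] = (m == 0)%:R * (k`!%:R * q.[a]).
Proof.
elim: k m q => [|k IH] m q.
  by rewrite derivn0 hornerM horner_exp hornerXsubC subrr expr0n fact0 mul1r.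
rewrite derivSn addSn derivM deriv_exp derivXsubC mul1r /= exprS.
have -> : ('X - a%:P) ^+ (k + m) *+ (k + m).+1 * q +
    ('X - a%:P) * ('X - a%:P) ^+ (k + m) * q^`() =
    ('X - a%:P) ^+ (k + m) * (q *+ (k + m).+1 + ('X - a%:P) * q^`()).
  by rewrite mulrDr mulrnAl mulrnAr; congr (_ + _); ring.
rewrite IH hornerD hornerM hornerMn hornerXsubC subrr mul0r addr0.
case: m => [|m]; last by rewrite !mul0r.
by rewrite addn0 !mul1r factS natrM mulr_natl; ring.
Qed.

Definition rodrigues (n : nat) : {poly R} := ('X^2 - 1) ^+ n.

Lemma rodrigues_factor1 n : rodrigues n = ('X - 1%:P) ^+ n * ('X + 1%:P) ^+ n.
Proof. by rewrite -exprMn /rodrigues; congr (_ ^+ n); rewrite polyC1; ring. Qed.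

Lemma rodrigues_factorN1 n :
  rodrigues n = ('X - (-1)%:P) ^+ n * ('X - 1%:P) ^+ n.
Proof.
by rewrite rodrigues_factor1 mulrC polyCN opprK.
Qed.

Lemma rodrigues_root1 n k : (k < n)%N -> (rodrigues n)^`(k).[1] = 0.
Proof.
move=> kn; rewrite rodrigues_factor1 -{1}(subnKC (ltnW kn)) derivn_XsubCn.
by rewrite subn_eq0 leqNgt kn mul0r.
Qed.

Lemma rodrigues_rootN1 n k : (k < n)%N -> (rodrigues n)^`(k).[-1] = 0.
Proof.
move=> kn; rewrite rodrigues_factorN1 -{1}(subnKC (ltnW kn)) derivn_XsubCn.
by rewrite subn_eq0 leqNgt kn mul0r.
Qed.

Lemma legendre1 n : (legendre R n).[1] = 1.
Proof.
rewrite /legendre hornerZ -/(rodrigues n) rodrigues_factor1.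
have := derivn_XsubCn 1 n 0 (('X + 1%:P) ^+ n); rewrite addn0 => ->.
rewrite horner_exp hornerD hornerX hornerC mul1r [_%:R * _]mulrC.
by rewrite mulVf// mulf_neq0 ?expf_neq0 ?pnatr_eq0 -?lt0n ?fact_gt0.
Qed.

Lemma deriv_rodrigues n :
  ('X^2 - 1) * (rodrigues n)^`() = n.*2%:R * 'X * rodrigues n.
Proof.
case: n => [|n].
  by rewrite /rodrigues expr0 -polyC1 derivC mulr0 double0 !mul0r.
rewrite /rodrigues deriv_exp derivB derivXn -polyC1 derivC subr0 /= expr1.
rewrite -['X *+ 2]mulr_natr -[_ *+ n.+1]mulr_natr -muln2 natrM.
by move: ('X^2 - _) => p; rewrite exprS; ring.
Qed.

(** This is [deriv_rodrigues] differentiated [k + 1] times; at [k = n] it becomes Legendre's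
    equation. *)
Lemma derivn_rodrigues n k :
  ('X^2 - 1) * (rodrigues n)^`(k.+2) =
  2%:R * (n%:R - k.+1%:R) * 'X * (rodrigues n)^`(k.+1) +
  k.+1%:R * (n.*2%:R - k%:R) * (rodrigues n)^`(k).
Proof.
have dnat (m : nat) : (m%:R : {poly R})^`() = 0.
  by rewrite -[m%:R]polyC_natr derivC.
have dX2 : ('X^2 - 1 : {poly R})^`() = 2%:R * 'X.
  by rewrite derivB derivXn -[1]/(1%:R) dnat subr0 /= expr1 mulr_natl.
elim: k => [|k IH].
  have /(congr1 deriv) := deriv_rodrigues n.
  rewrite !derivM dX2 dnat derivX derivn0 derivn1 derivnS derivn1.
  rewrite -muln2 natrM.
  set v := rodrigues n; set v1 := v^`(); set v2 := v1^`() => H.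
  have -> : ('X^2 - 1) * v2 = (2%:R * 'X * v1 + ('X^2 - 1) * v2) - 2%:R * 'X * v1.
    by ring.
  by rewrite H; ring.
move/(congr1 deriv): IH.
rewrite derivM dX2 derivD !derivM !derivB !dnat derivX -!derivnS.
rewrite -muln2 natrM.
set v := (rodrigues n)^`(k.+2); set v1 := (_)^`(k.+3) => H.
have -> : ('X^2 - 1) * v1 = (2%:R * 'X * v + ('X^2 - 1) * v1) - 2%:R * 'X * v.
  by ring.
by rewrite H -!(natr1 k.+1) -!(natr1 k); ring.
Qed.

Lemma legendre_ode n :
  ('X^2 - 1) * (legendre R n)^`(2) =
  n%:R * n.+1%:R * legendre R n - 2%:R * 'X * (legendre R n)^`().
Proof.
rewrite /legendre -/(rodrigues n) derivnS derivn1 !derivZ -!derivnS.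
rewrite -scalerAr derivn_rodrigues -!scalerAr -scalerBr.
by congr (_ *: _); rewrite -muln2 natrM -(natr1 n); ring.
Qed.

Lemma rodrigues_opp n k :
  (rodrigues n)^`(k) \Po (- 'X) = (-1) ^+ k *: (rodrigues n)^`(k).
Proof.
elim: k => [|k IH].
  rewrite derivn0 scale1r /rodrigues rmorphXn rmorphB /= rmorph1 comp_Xn_poly.
  by rewrite sqrrN.
have /(congr1 deriv) := IH; rewrite deriv_comp derivZ -derivnS derivN derivX.
by rewrite mulrN1 exprS -scalerA => <-; rewrite scaleN1r opprK.
Qed.

Lemma legendreN n x : (legendre R n).[- x] = (-1) ^+ n * (legendre R n).[x].
Proof.
rewrite /legendre !hornerZ -/(rodrigues n).
have := congr1 (horner^~ x) (rodrigues_opp n n).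
by rewrite /= horner_comp hornerN hornerX hornerZ => ->; ring.
Qed.

Lemma deriv_legendreN n x :
  (legendre R n)^`().[- x] = - (-1) ^+ n * (legendre R n)^`().[x].
Proof.
rewrite /legendre !derivZ !hornerZ -/(rodrigues n) -derivnS.
have := congr1 (horner^~ x) (rodrigues_opp n n.+1).
by rewrite /= horner_comp hornerN hornerX hornerZ exprS => ->; ring.
Qed.

Lemma size_legendre n : size (legendre R n) = n.+1.
Proof.
have lk : (legendre R n)`_n != 0.
  rewrite /legendre coefZ coef_derivn mulf_neq0//.
  rewrite -mulr_natr mulf_neq0 ?pnatr_eq0 -?lt0n ?ffact_gt0 ?leq_addr//.
  have /monicP : ('X^2 - 1) ^+ n \is @monic R.
    by rewrite monic_exp// -polyC1 monicXnsubC.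
  rewrite /lead_coef size_exp -polyC1 size_XnsubC// /= mul2n addnn.
  by move->; rewrite oner_eq0.
apply/eqP; rewrite eqn_leq; apply/andP; split; last first.
  by rewrite ltnNge; apply: contra lk => /leq_sizeP/(_ n (leqnn _)) ->.
apply/leq_sizeP => j nj; rewrite /legendre coefZ coef_derivn.
rewrite nth_default ?mul0rn ?mulr0// -polyC1.
rewrite (leq_trans (size_poly_exp_leq _ _))// size_XnsubC// /=; lia.
Qed.

(** Integrate by parts [n] times: the boundary terms vanish because -1 and 1 are roots of order [n]
    of [rodrigues n], and the [n]-th derivative of [q] is zero. *)
Lemma pint_legendre n q : (size q <= n)%N -> pint (legendre R n * q) = 0.
Proof.
move=> qn; rewrite /legendre -scalerAl pintZ -/(rodrigues n).
suff H k : (k <= n)%N -> pint ((rodrigues n)^`(k) * q) =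
    (-1) ^+ k * pint (rodrigues n * q^`(k)).
  rewrite H// derivn_poly0// mulr0.
  by rewrite -[X in pint X](scale0r (0 : {poly R})) pintZ mul0r !mulr0.
elim: k q {qn} => [|k IH] q kn; first by rewrite mul1r.
rewrite derivnS pint_parts !hornerM rodrigues_root1// rodrigues_rootN1//.
by rewrite !mul0r subrr sub0r (IH _ (ltnW kn)) -derivSn exprS; ring.
Qed.

End Legendre.

(** * Exactness, nodes and weights of Gauss quadrature *)

Section GaussRule.
Context {R : realType} (n : nat) (x w : 'I_n -> R) (Gxw : gauss x w).
Implicit Types p q : {poly R}.
Let L := legendre R n.

(** Divide by [L]: the quotient is orthogonal to [L], and the remainder has degree below [n] and the
    values of [p] at the nodes. *)
Lemma gauss_exact p : (size p <= n + n)%N -> pint p = \sum_(k < n) w k * p.[x k].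
Proof.
have [_ xL intp] := Gxw => sp.
have L0 : L != 0 by rewrite -size_poly_gt0 size_legendre.
rewrite (divp_eq p L) mulrC pintD pint_legendre ?add0r; last first.
  by rewrite size_divp// size_legendre leq_subLR.
have -> : pint (p %% L) = \sum_(k < n) w k * (p %% L).[x k].
  apply/eqP; rewrite -subr_eq0; apply/eqP/intp.
  by rewrite -ltnS -(size_legendre (R := R) n) ltn_modp.
apply: eq_bigr => k _.
by rewrite hornerD hornerM (rootP (xL k)) mul0r add0r.
Qed.

Section Node.
Variable k : 'I_n.

(** Up to a scalar, [q] is the Lagrange basis polynomial of the node, so testing the rule on
    multiples of [q ^+ 2] isolates [w k]. *)
Lemma gauss_node_factor : exists q,
  [/\ L = ('X - (x k)%:P) * q, (size q <= n)%N,
      forall i, i != k -> q.[x i] = 0 & L^`().[x k] = q.[x k]].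
Proof.
have [xinj xL _] := Gxw.
have /factor_theorem[q Lq] := xL k; exists q.
have q0 : q != 0.
  apply/eqP => q0; move: Lq; rewrite q0 mul0r => /(congr1 (size \o polyseq)).
  by rewrite /= size_legendre size_poly0.
split.
- by rewrite mulrC.
- move: (congr1 (size \o polyseq) Lq); rewrite /= size_legendre.
  by rewrite size_Mmonic ?monicXsubC// size_XsubC addn2 => -[->].
- move=> i ik; have := xL i; rewrite Lq rootM root_XsubC (inj_eq xinj).
  by rewrite (negPf ik) orbF => /rootP.
- rewrite /L Lq derivM derivXsubC mulr1 hornerD hornerM hornerXsubC subrr.
  by rewrite mulr0 add0r.
Qed.

(** The rule is exact on [p * q ^+ 2] for [p] of degree at most 1. Nonnegative integrands locate the
    node and give the sign of the weight; the weight formula comes from integrating the derivative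
    of [(X - x k) * q ^+ 2]. *)
Lemma gauss_weightE :
  [/\ -1 < x k < 1, 0 < w k &
      w k * ((1 - x k ^+ 2) * L^`().[x k] ^+ 2) = 2].
Proof.
have [q [Lq sq qi Lqk]] := gauss_node_factor.
have n0 : (0 < n)%N by case: (n) k => // -[].
have q0 : q != 0.
  apply/eqP => q0; move: Lq; rewrite q0 mulr0 => /(congr1 (size \o polyseq)).
  by rewrite /= size_legendre size_poly0.
have sq2 : (size (q ^+ 2) < n + n)%N.
  rewrite expr2 (leq_ltn_trans (size_polyMleq _ _))//.
  by rewrite -subn1 ltn_subLR ?addn_gt0 ?size_poly_gt0 ?q0// add1n ltnS leq_add.
have sumk p : \sum_(i < n) w i * (p * q ^+ 2).[x i] =
    w k * (p.[x k] * q.[x k] ^+ 2).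
  rewrite (bigD1 k)//= big1 ?addr0 ?hornerM ?horner_exp// => i ik.
  by rewrite hornerM horner_exp qi// expr0n !mulr0.
have I1 : 0 < w k * q.[x k] ^+ 2.
  rewrite -[q.[x k] ^+ 2]mul1r -(hornerC 1 (x k)) -sumk polyC1 mul1r.
  rewrite -gauss_exact; last exact: ltnW.
  by rewrite pint_gt0 ?expf_neq0// => y _; rewrite horner_exp sqr_ge0.
(* For [c] equal to 1 or -1 the integrand [(1 + c X) * q ^+ 2] is nonnegative on [-1, 1]; dividing
   by the quantity of [I1] then gives [1 + c * x k > 0]. *)
have Ic (c : R) : c ^+ 2 = 1 -> 0 < w k * q.[x k] ^+ 2 * (1 + c * x k).
  move=> c1.
  have -> : w k * q.[x k] ^+ 2 * (1 + c * x k) =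
    w k * ((1 + c *: 'X).[x k] * q.[x k] ^+ 2).
    by rewrite hornerD hornerZ hornerX hornerC; ring.
  have c0 : c != 0 by apply: contra_eq_neq c1 => ->; rewrite expr0n eq_sym oner_eq0.
  have sc : size (1 + c *: 'X : {poly R}) = 2.
    by rewrite addrC size_polyDl ?size_scale ?size_polyX ?size_poly1.
  rewrite -sumk -gauss_exact; last first.
    by rewrite (leq_trans (size_polyMleq _ _))// sc.
  apply: pint_gt0.
    by rewrite mulf_neq0 ?expf_neq0// -size_poly_gt0 sc.
  move=> y y1; rewrite hornerM horner_exp mulr_ge0 ?sqr_ge0//.
  rewrite hornerD hornerZ hornerX hornerC.
  have /orP[/eqP->|/eqP->] : (c == 1) || (c == -1) by rewrite -eqf_sqr c1 expr1n.
    by lra.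
  by lra.
have x1 : -1 < x k < 1.
  have := Ic 1 (expr1n _ _); have := Ic (-1) (sqrr_sign _ 1).
  by rewrite !(pmulr_rgt0 _ I1) => H1 H2; apply/andP; split; lra.
have wk : 0 < w k.
  rewrite -(pmulr_lgt0 _ (_ : 0 < q.[x k] ^+ 2))// lt0r sqr_ge0 sqrf_eq0 andbT.
  by apply: contraTneq I1 => ->; rewrite expr0n mulr0 ltxx.
split=> //.
have L1 := legendre1 (R := R) n; have LN1 := legendreN n (1 : R).
rewrite legendre1 mulr1 in LN1.
have q1 : (1 - x k) ^+ 2 * q.[1] ^+ 2 = 1.
  by rewrite -exprMn -[1 - x k](hornerXsubC _ 1) -hornerM -Lq L1 expr1n.
have qN1 : (1 + x k) ^+ 2 * q.[-1] ^+ 2 = 1.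
  rewrite -exprMn -[RHS](sqrr_sign _ n) -LN1 -/L Lq hornerM hornerXsubC.
  by ring.
(* In the product rule the cross term is [2 L q'], which orthogonality kills; only boundary values
   remain, and [L] is 1 or -1 there. *)
have : pint (q ^+ 2) = (1 - x k) * q.[1] ^+ 2 + (1 + x k) * q.[-1] ^+ 2.
  have := pint_deriv (('X - (x k)%:P) * q ^+ 2).
  rewrite derivM derivXsubC mul1r deriv_exp /= expr1.
  have -> : ('X - (x k)%:P) * (q^`() * q *+ 2) = L * (q^`() *+ 2).
    by rewrite Lq; ring.
  rewrite pintD pint_legendre ?addr0; last first.
    rewrite mulr2n (leq_trans (size_polyD _ _))// maxnn.
    exact: ltnW (leq_trans (lt_size_deriv q0) sq).
  by move->; rewrite !hornerM !hornerXsubC; ring.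
rewrite gauss_exact ?(ltnW sq2)//.
have -> : \sum_(i < n) w i * (q ^+ 2).[x i] = w k * q.[x k] ^+ 2.
  by have := sumk 1; rewrite mul1r hornerC mul1r.
rewrite Lqk => E.
have -> : w k * ((1 - x k ^+ 2) * q.[x k] ^+ 2) =
    (1 - x k ^+ 2) * (w k * q.[x k] ^+ 2) by ring.
rewrite E.
have -> : (1 - x k ^+ 2) * ((1 - x k) * q.[1] ^+ 2 + (1 + x k) * q.[-1] ^+ 2) =
    (1 + x k) * ((1 - x k) ^+ 2 * q.[1] ^+ 2) +
    (1 - x k) * ((1 + x k) ^+ 2 * q.[-1] ^+ 2) by ring.
by rewrite q1 qN1; ring.
Qed.

End Node.
End GaussRule.

(** * Derivatives and monotonicity of explicit real functions *)

Section ExplicitDerivatives.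
Context {R : realType}.
Implicit Types (f g : R -> R) (x a b : R).

Lemma is_derive_addfun f g x a b : is_derive x 1 f a -> is_derive x 1 g b ->
  is_derive x 1 (fun t => f t + g t) (a + b).
Proof. by move=> df dg; exact: is_deriveD. Qed.

Lemma is_derive_oppfun f x a : is_derive x 1 f a ->
  is_derive x 1 (fun t => - f t) (- a).
Proof. by move=> df; exact: is_deriveN. Qed.

Lemma is_derive_mulfun f g x a b : is_derive x 1 f a -> is_derive x 1 g b ->
  is_derive x 1 (fun t => f t * g t) (a * g x + f x * b).
Proof.
move=> df dg; apply: (is_derive_eq (is_deriveM df dg)).
by rewrite /GRing.scale /=; ring.
Qed.

Lemma is_derive_expfun f n x a : is_derive x 1 f a ->
  is_derive x 1 (fun t => f t ^+ n) (n%:R * f x ^+ n.-1 * a).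
Proof.
by move=> df; have := is_deriveX n df; rewrite exprfctE.
Qed.

Lemma is_derive_invfun f x a : f x != 0 -> is_derive x 1 f a ->
  is_derive x 1 (fun t => (f t)^-1) (- a / f x ^+ 2).
Proof.
move=> fx0 df; apply: (is_derive_eq (is_deriveV fx0 df)).
by rewrite /GRing.scale /=; ring.
Qed.

Lemma is_derive_compfun f g x a b : is_derive (g x) 1 f a ->
  is_derive x 1 g b -> is_derive x 1 (fun t => f (g t)) (a * b).
Proof. by move=> df dg; exact: is_derive1_comp. Qed.

(* The existential keeps typeclass resolution from choosing [a]. *)
Lemma is_derive_ex f x b : (exists2 a, is_derive x 1 f a & a = b) ->
  is_derive x 1 f b.
Proof. by case=> a df <-. Qed.

Lemma nonincreasing_derive_cc f (df : R -> R) a b : a <= b ->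
  (forall t, a <= t <= b -> is_derive t 1 f (df t)) ->
  (forall t, a < t < b -> df t <= 0) -> f b <= f a.
Proof.
move=> ab Df df_le0.
apply: (@ler0_derive1_nincr _ f a b) => // [t|t|].
- rewrite in_itv/= => /andP[at_ tb].
  by have [] := Df t; rewrite // !ltW.
- rewrite in_itv/= => /andP[at_ tb].
  have dt : is_derive t 1 f (df t) by apply: Df; rewrite !ltW.
  by rewrite derive1E derive_val df_le0// at_.
- apply: derivable_within_continuous => t; rewrite in_itv/= => tI.
  by have [] := Df t tI.
Qed.

(** The interval is open on the left because the functions compared below are singular at 0; the
    comparison is with the right end, later [pi / 2]. *)
Lemma nonincreasing_derive f (df : R -> R) x a b :
  (forall t, a < t <= b -> is_derive t 1 f (df t)) ->
  (forall t, a < t < b -> df t <= 0) ->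
  a < x <= b -> f b <= f x.
Proof.
move=> Df df_le0 /andP[ax xb]; apply: (nonincreasing_derive_cc xb) => t /andP[xt tb].
  by apply: Df; rewrite tb (lt_le_trans ax).
by apply: df_le0; rewrite tb (lt_trans ax).
Qed.

End ExplicitDerivatives.

(** Meant for goals opened by [is_derive_ex], whose derivative is still unknown. Hypotheses come
    before the general rules, so that known derivatives of functions such as [u] and [v] are
    used. *)
Ltac derive_fun :=
  repeat first
  [ eassumption
  | match goal with H : _ |- is_derive _ _ _ _ => eapply H end
  | eapply is_derive_cst
  | eapply is_derive_id
  | eapply is_derive_poly
  | eapply is_derive_sin
  | eapply is_derive_cos
  | eapply is_derive_addfun
  | eapply is_derive_oppfun
  | eapply is_derive_mulfun
  | eapply is_derive_expfun
  | eapply is_derive_invfun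
  | eapply is_derive_compfun ].

(** * Sonin and phase bounds for a perturbed harmonic oscillator *)

(* [u'' + Q u = 0] is the Liouville normal form of Legendre's equation in [cos t]. *)
Section Pruefer.
Context {R : realType} (N : R) (u v : R -> R).
Hypothesis N_gt0 : 0 < N.
Let Q (t : R) := N ^+ 2 + (4 * sin t ^+ 2)^-1.
Hypothesis Du : forall t : R, 0 < t < pi -> is_derive t 1 u (v t).
Hypothesis Dv : forall t : R, 0 < t < pi -> is_derive t 1 v (- (Q t * u t)).
Let psi (t : R) := N * t - pi / 4.
(** For a solution of [u'' + N^2 u = 0] this would be constant; here its derivative is
    [- u cos psi / (4 sin^2 t)]. *)
Let W t := v t * cos (psi t) + N * u t * sin (psi t).
Hypothesis W_pihalf : W (pi / 2) = 0.
Let S0 := v (pi / 2) ^+ 2 + Q (pi / 2) * u (pi / 2) ^+ 2.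

Let range (t : R) : 0 < t <= pi / 2 -> 0 < t < pi.
Proof. by have := pi_gt0 R => pi0 /andP[t0 tp]; apply/andP; split; lra. Qed.

Let sin_pos (t : R) : 0 < t <= pi / 2 -> 0 < sin t.
Proof. by move=> /range; exact: sin_gt0_pi. Qed.

Let cos_pos (t : R) : 0 < t < pi / 2 -> 0 < cos t.
Proof.
move=> /andP[t0 tp]; apply: cos_gt0_pihalf; rewrite tp andbT.
by have := pi_gt0 R; lra.
Qed.

Let Q_gt0 (t : R) : 0 < Q t.
Proof. by rewrite ltr_pwDl ?exprn_gt0// invr_ge0 mulr_ge0// sqr_ge0. Qed.

Let DQ (t : R) : 0 < t <= pi / 2 ->
  is_derive t 1 Q (- cos t / (2 * sin t ^+ 3)).
Proof.
move=> tI; have s0 := lt0r_neq0 (sin_pos tI).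
rewrite /Q; apply: is_derive_ex; eexists; first by derive_fun; rewrite mulf_neq0// expf_neq0.
by rewrite /=; field.
Qed.

(** The right-hand side has derivative [Q' u^2], and [Q] decreases on (0, pi / 2]. At a zero of [u]
    this bounds [v] from below. *)
Lemma sonin_le (t : R) : 0 < t <= pi / 2 -> S0 <= v t ^+ 2 + Q t * u t ^+ 2.
Proof.
pose dS t := - cos t / (2 * sin t ^+ 3) * u t ^+ 2.
apply: (@nonincreasing_derive _ (fun t => v t ^+ 2 + Q t * u t ^+ 2) dS)
  => {}t tI.
  have Dut := Du (range tI); have Dvt := Dv (range tI); have DQt := DQ tI.
  by apply: is_derive_ex; eexists; [derive_fun|rewrite /dS /=; ring].
have sp : 0 < sin t by apply: sin_pos; case/andP: tI => ? ?; apply/andP; split=> //; exact: ltW.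
have cp := cos_pos tI.
rewrite /dS !mulNr oppr_le0 mulr_ge0 ?sqr_ge0// divr_ge0 ?ltW//.
by rewrite mulr_gt0// exprn_gt0.
Qed.

(** The companion function [u^2 + v^2 / Q] has derivative [- Q' v^2 / Q^2 >= 0], so it is largest at
    [pi / 2]. *)
Lemma sonin_ge (t : R) : 0 < t <= pi / 2 -> u t ^+ 2 <= S0 / Q (pi / 2).
Proof.
have -> : S0 / Q (pi / 2) = u (pi / 2) ^+ 2 + v (pi / 2) ^+ 2 / Q (pi / 2).
  by rewrite /S0; field; rewrite gt_eqF.
move=> tI; apply: (@le_trans _ _ (u t ^+ 2 + v t ^+ 2 / Q t)).
  by rewrite lerDl divr_ge0 ?sqr_ge0// ltW.
rewrite -lerN2.
pose dS t := - (cos t / (2 * sin t ^+ 3) * v t ^+ 2 / Q t ^+ 2).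
apply: (@nonincreasing_derive _ (fun t => - (u t ^+ 2 + v t ^+ 2 / Q t)) dS _ 0) => // {}t {}tI.
  have Dut := Du (range tI); have Dvt := Dv (range tI); have DQt := DQ tI.
  have Q0 := lt0r_neq0 (Q_gt0 t).
  have s0 := lt0r_neq0 (sin_pos tI).
  apply: is_derive_ex; eexists; first by derive_fun.
  by rewrite /dS /=; field; rewrite Q0 s0.
have sp : 0 < sin t by apply: sin_pos; case/andP: tI => ? ?; apply/andP; split=> //; exact: ltW.
have cp := cos_pos tI.
rewrite /dS oppr_le0 divr_ge0 ?sqr_ge0// mulr_ge0 ?sqr_ge0//.
by rewrite divr_ge0 ?ltW// mulr_gt0// exprn_gt0.
Qed.


(** With [K] the bound on [|u|] from [sonin_ge], the derivative of [W] is at most [K / (4 sin^2 t)]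
    in absolute value, and [cot] has derivative [- 1 / sin^2]; both [W] and [cot] vanish at
    [pi / 2]. *)
Lemma phase_le (t : R) : 0 < t <= pi / 2 ->
  `|W t| <= Num.sqrt (S0 / Q (pi / 2)) / 4 * (cos t / sin t).
Proof.
move=> tI; set K := Num.sqrt _.
have uK (r : R) : 0 < r <= pi / 2 -> `|u r| <= K.
  by move=> rI; rewrite -sqrtr_sqr ler_sqrt ?sonin_ge// (le_trans (sqr_ge0 _) (sonin_ge rI)).
have K0 : 0 <= K by exact: sqrtr_ge0.
(* The signs [e = 1] and [e = -1] give the two halves of the absolute value. *)
have key (e : R) : `|e| = 1 -> 0 <= K / 4 * (cos t / sin t) + e * W t.
  move=> e1; pose g r := K / 4 * (cos r / sin r) + e * W r.
  pose dg r := - (K + e * (u r * cos (psi r))) / (4 * sin r ^+ 2).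
  have -> : 0 = g (pi / 2) by rewrite /g cos_pihalf W_pihalf; ring.
  apply: (@nonincreasing_derive _ g dg) tI => {}t tI.
    have Dut := Du (range tI); have Dvt := Dv (range tI).
    have s0 := lt0r_neq0 (sin_pos tI).
    rewrite /g /W /psi; apply: is_derive_ex; eexists; first by derive_fun.
    rewrite /dg /psi /= /Q.
    have c2 : cos t ^+ 2 = 1 - sin t ^+ 2 by rewrite -(cos2Dsin2 t); ring.
    have -> : - (K + e * (u t * cos (N * t - pi / 4))) / (4 * sin t ^+ 2) =
      - (K * (cos t ^+ 2 + sin t ^+ 2) + e * (u t * cos (N * t - pi / 4))) / (4 * sin t ^+ 2).
      by rewrite cos2Dsin2 mulr1.
    by field.
  have tI' : 0 < t <= pi / 2 by case/andP: tI => ? ?; apply/andP; split=> //; exact: ltW.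
  rewrite /dg mulNr oppr_le0 divr_ge0//; last first.
    by rewrite mulr_ge0// sqr_ge0.
  suff : `|e * (u t * cos (psi t))| <= K by rewrite ler_norml => /andP[]; lra.
  rewrite normrM e1 mul1r normrM -[K]mulr1 ler_pM ?uK//.
  by rewrite ler_norml cos_geN1 cos_le1.
have := key 1 (normr1 _); have := key (-1) (normrN1 _).
by rewrite ler_norml => H1 H2; apply/andP; split; lra.
Qed.

(* At a zero of [u] we have [W = v * cos psi] and [|v| >= sqrt S0], so the factor
   [sqrt S0] cancels from [phase_le]. *)
Lemma phase_at_zero (t c : R) : 0 < t <= pi / 2 -> u t = 0 ->
  0 < c -> c <= S0 ->
  0 < v t ^+ 2 /\ `|cos (psi t)| * (sin t / v t ^+ 2) <= (4 * N * c)^-1.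
Proof.
move=> tI ut0 c0 cS.
have S0v : S0 <= v t ^+ 2 by have := sonin_le tI; rewrite ut0 expr0n mulr0 addr0.
have S0_gt0 : 0 < S0 by exact: lt_le_trans cS.
have v2 : 0 < v t ^+ 2 by exact: lt_le_trans S0v.
split=> //.
have s0 := sin_pos tI.
have := phase_le tI; rewrite /W ut0 mulr0 mul0r addr0 normrM => H.
have vS : Num.sqrt S0 <= `|v t| by rewrite -sqrtr_sqr ler_sqrt// sqr_ge0.
have sS0 : 0 < Num.sqrt S0 by rewrite sqrtr_gt0.
have QN : Num.sqrt (S0 / Q (pi / 2)) <= Num.sqrt S0 / N.
  rewrite -[X in _ <= X / _](ger0_norm (sqrtr_ge0 _)).
  rewrite -[N in _ / N](ger0_norm (ltW N_gt0)) -normf_div -sqrtr_sqr ler_sqrt ?sqr_ge0//.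
  rewrite exprMn (sqr_sqrtr (ltW S0_gt0)) exprVn ler_pM2l// lef_pV2 ?posrE ?exprn_gt0//.
  by rewrite lerDl invr_ge0 mulr_ge0// sqr_ge0.
have step : `|v t| * (`|cos (psi t)| * sin t) <= `|v t| / (4 * N).
  rewrite mulrA; apply: (@le_trans _ _ (Num.sqrt (S0 / Q (pi / 2)) / 4 * (cos t / sin t) * sin t)).
    by rewrite ler_pM2r.
  rewrite -mulrA divfK ?gt_eqF//.
  apply: (@le_trans _ _ (Num.sqrt S0 / N / 4 * 1)); last first.
    by rewrite mulr1 -mulrA -invfM [N * 4]mulrC ler_pM2r// invr_gt0 mulr_gt0.
  apply: ler_pM => //.
  - case/andP: tI => t0 tp; rewrite cos_ge0_pihalf// tp andbT.
    by have := pi_gt0 R; lra.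
  - by rewrite ler_pM2r.
have vn0 : 0 < `|v t| by exact: lt_le_trans vS.
move: step; rewrite ler_pM2l// => step.
rewrite mulrA [(4 * N * c)^-1]invfM; apply: ler_pM => //.
- by rewrite mulr_ge0// ltW.
- by rewrite invr_ge0 ltW.
by rewrite lef_pV2 ?posrE// (le_trans cS).
Qed.

End Pruefer.

(** * Legendre polynomials at [cos t]: amplitude, and phase at the zeros *)

Section LegendreOscillation.
Context {R : realType}.

Lemma cosDnatpi (m : nat) (a : R) : cos (m%:R * pi + a) = (-1) ^+ m * cos a.
Proof.
elim: m a => [|m IH] a; first by rewrite mul0r add0r mul1r.
rewrite -natr1 mulrDl mul1r -addrA IH [pi + a]addrC cosDpi exprSr.
by rewrite mulrN1 mulNr mulrN.
Qed.

Lemma sin_natpi (m : nat) : sin (m%:R * pi : R) = 0.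
Proof.
elim: m => [|m IH]; first by rewrite mul0r sin0.
by rewrite -natr1 mulrDl mul1r sinDpi IH oppr0.
Qed.

(** Compare derivatives twice: [sin <= 1] gives [cos t >= 1 - t], which is at least 1/2 on this
    range. *)
Lemma sin_ge_half (x : R) : 0 <= x <= 1 / 2 -> x / 2 <= sin x.
Proof.
have cos_ge (t : R) : 0 <= t -> 1 - t <= cos t.
  move=> t0; suff : - (cos t + t) <= - (cos 0 + 0) by rewrite cos0; lra.
  apply: (@nonincreasing_derive_cc _ (fun t => - (cos t + t))
    (fun t => sin t - 1) _ _ t0) => z _; last by rewrite subr_le0 sin_le1.
  by apply: is_derive_ex; eexists; [derive_fun|rewrite /=; ring].
move=> /andP[x0 x1].
suff : - (sin x - x / 2) <= - (sin 0 - 0 / 2) by rewrite sin0; lra.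
apply: (@nonincreasing_derive_cc _ (fun t => - (sin t - t / 2))
    (fun t => 1 / 2 - cos t) _ _ x0) => z.
  by move=> _; apply: is_derive_ex; eexists; [derive_fun|rewrite /=; ring].
by move=> /andP[z0 z1]; have := cos_ge z (ltW z0); lra.
Qed.

Variable n : nat.
Hypothesis n_gt0 : (0 < n)%N.
Let L := legendre R n.
Let N : R := n%:R + 1 / 2.
Let y (t : R) : R := L.[cos t].
Let y1 (t : R) : R := - (sin t * L^`().[cos t]).
Let y2 (t : R) : R := sin t ^+ 2 * L^`(2).[cos t] - cos t * L^`().[cos t].

Let N_gt1 : 1 < N.
Proof.
have n1 : (1 : R) <= n%:R by rewrite ler1n.
by rewrite /N; lra.
Qed.

Let Dy (t : R) : is_derive t 1 y (y1 t).
Proof.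
by apply: is_derive_ex; eexists; [rewrite /y; derive_fun|rewrite /y1 /=; ring].
Qed.

Let Dy1 (t : R) : is_derive t 1 y1 (y2 t).
Proof.
apply: is_derive_ex; eexists; [rewrite /y1; derive_fun|].
by rewrite /y2 derivnS derivn1 /=; ring.
Qed.

(** Legendre's equation in the variable [t], kept multiplied by [sin t] so that it also holds where
    [sin t] vanishes. *)
Lemma legendre_ode_cos t :
  sin t * y2 t = - (cos t * y1 t + n%:R * n.+1%:R * sin t * y t).
Proof.
have natE m : (m%:R : {poly R}).[cos t] = m%:R by rewrite -polyC_natr hornerC.
have /(congr1 (horner^~ (cos t))) := legendre_ode (R := R) n.
rewrite /= -polyC1 !(hornerM, hornerD, hornerN, hornerXn, hornerX, natE, hornerC).
rewrite -/L -/(y t) => H.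
have s2 : cos t ^+ 2 - 1 = - sin t ^+ 2 by rewrite -(cos2Dsin2 t); ring.
rewrite /y2 /y1.
have -> : sin t * (sin t ^+ 2 * L^`(2).[cos t] - cos t * L^`().[cos t]) =
  - sin t * (- sin t ^+ 2 * L^`(2).[cos t]) - sin t * cos t * L^`().[cos t] by ring.
rewrite -s2 H.
ring.
Qed.

Let u (t : R) : R := Num.sqrt (sin t) * y t.
Let v (t : R) : R := Num.sqrt (sin t) * y1 t + cos t / (2 * Num.sqrt (sin t)) * y t.

Let Dsqrt_sin (t : R) : 0 < t < pi ->
  is_derive t 1 (fun t => Num.sqrt (sin t)) (cos t / (2 * Num.sqrt (sin t))).
Proof.
move=> tI; apply: is_derive_ex; eexists.
  exact: is_derive_compfun (is_derive1_sqrt (sin_gt0_pi tI)) (is_derive_sin t).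
by rewrite mulrC.
Qed.

Let Du (t : R) : 0 < t < pi -> is_derive t 1 u (v t).
Proof.
move=> tI; have Ds := Dsqrt_sin tI; have D0 := Dy t.
by apply: is_derive_ex; eexists; [rewrite /u; derive_fun|rewrite /v /=; ring].
Qed.

Let Dv (t : R) : 0 < t < pi ->
  is_derive t 1 v (- ((N ^+ 2 + (4 * sin t ^+ 2)^-1) * u t)).
Proof.
move=> tI; have Ds := Dsqrt_sin tI; have D0 := Dy t; have D1 := Dy1 t.
have sp : 0 < sin t by exact: sin_gt0_pi.
have q0 : Num.sqrt (sin t) != 0 by rewrite gt_eqF// sqrtr_gt0.
apply: is_derive_ex; eexists; first by rewrite /v; derive_fun; rewrite mulf_neq0.
have := legendre_ode_cos t.
have := cos2Dsin2 t.
have := sqr_sqrtr (ltW sp).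
rewrite /u /=.
move: (Num.sqrt _) q0 => q q0 <- c2 ode.
have -> : y2 t = - (cos t * y1 t + n%:R * n.+1%:R * q ^+ 2 * y t) / q ^+ 2.
  by rewrite -ode mulrC mulKf// expf_neq0.
(* Here [q ^+ 2] is [sin t]; writing 1 as [cos^2 + sin^2] exposes the cancellation, which rests on
   [n (n + 1) + 1/4 = N^2]. *)
have -> : (4 * (q ^+ 2) ^+ 2)^-1 = (cos t ^+ 2 + (q ^+ 2) ^+ 2) / (4 * (q ^+ 2) ^+ 2).
  by rewrite c2 mul1r.
rewrite /N -(natr1 n).
by field.
Qed.

(** The phase at [pi / 2] is [n pi / 2]. By parity, [L] and the cosine of the phase vanish for odd
    [n], the derivative of [L] and the sine for even [n]. *)
Let W_pihalf : v (pi / 2) * cos (N * (pi / 2) - pi / 4) +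
  N * u (pi / 2) * sin (N * (pi / 2) - pi / 4) = 0.
Proof.
have -> : N * (pi / 2) - pi / 4 = n%:R * pi / 2 by rewrite /N; field.
rewrite /u /v sin_pihalf cos_pihalf sqrtr1 !mul0r addr0 !mul1r /y1 sin_pihalf /y.
rewrite cos_pihalf mul1r.
have := legendreN n (0 : R); have := deriv_legendreN n (0 : R).
rewrite oppr0 -/L -[n]odd_double_half; case: (odd n) => /=.
  rewrite add1n exprS -muln2 exprM sqrr_sign mulr1 mulN1r => _ L0.
  have -> : L.[0] = 0 by lra.
  have -> : (n./2 * 2).+1%:R * pi / 2 = n./2%:R * pi + pi / 2 :> R.
    by rewrite -natr1 natrM; field.
  by rewrite cosDpihalf sin_natpi; ring.
rewrite add0n -muln2 exprM sqrr_sign mul1r mulN1r => L1 _.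
have -> : L^`().[0] = 0 by lra.
have -> : (n./2 * 2)%:R * pi / 2 = n./2%:R * pi :> R by rewrite natrM; field.
by rewrite sin_natpi; ring.
Qed.

(** The left-hand side has derivative [- 2 sin t cos t L'(cos t)^2 <= 0] and starts at [n (n + 1)],
    because [L] is 1 at 1. It yields [|y1| <= N]. *)
Let energy_le (t : R) : 0 <= t <= pi / 2 ->
  y1 t ^+ 2 + n%:R * n.+1%:R * y t ^+ 2 <= n%:R * n.+1%:R.
Proof.
move=> /andP[t0 tp].
have E0 : n%:R * n.+1%:R = y1 0 ^+ 2 + n%:R * n.+1%:R * y 0 ^+ 2 :> R.
  by rewrite /y1 /y sin0 cos0 legendre1; ring.
rewrite [leRHS]E0.
apply: (@nonincreasing_derive_cc _ (fun t => y1 t ^+ 2 + n%:R * n.+1%:R * y t ^+ 2)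
  (fun t => - (2 * cos t * sin t * L^`().[cos t] ^+ 2)) _ _ t0) => r rI.
  have D0 := Dy r; have D1 := Dy1 r.
  apply: is_derive_ex; eexists; first by derive_fun.
  rewrite /=; transitivity (- 2 * L^`().[cos r] * (sin r * y2 r) +
      2 * (n%:R * n.+1%:R) * y r * y1 r); first by rewrite /y1; ring.
  by rewrite legendre_ode_cos /y1; ring.
have rI' : 0 < r < pi / 2 by case/andP: rI => r0 rt; rewrite r0 (lt_le_trans rt).
have s0 := sin_gt0_pihalf rI'.
have c0 : 0 < cos r.
  by apply: cos_gt0_pihalf; case/andP: rI' => r0 ->; have := pi_gt0 R; lra.
rewrite oppr_le0; apply: mulr_ge0; last exact: sqr_ge0.
by rewrite !mulr_ge0 ?(ltW s0) ?(ltW c0).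
Qed.

Let y_ge (t : R) : 0 <= t <= pi / 2 -> 1 - N * t <= y t.
Proof.
move=> /andP[t0 tp].
suff : - (y t + N * t) <= - (y 0 + N * 0) by rewrite {2}/y cos0 legendre1; lra.
apply: (@nonincreasing_derive_cc _ (fun t => - (y t + N * t))
  (fun t => - (y1 t + N)) _ _ t0) => r /andP[r0 rt].
  have D0 := Dy r.
  by apply: is_derive_ex; eexists; [derive_fun|rewrite /=; ring].
have E : y1 r ^+ 2 <= N ^+ 2.
  have rI : 0 <= r <= pi / 2 by rewrite ltW// ltW// (lt_le_trans rt).
  have := energy_le rI.
  have : 0 <= n%:R * n.+1%:R * y r ^+ 2 by rewrite mulr_ge0 ?sqr_ge0// mulr_ge0.
  by rewrite /N -(natr1 n); nra.
have : `|y1 r| <= N by rewrite -[N]gtr0_norm ?(lt_trans ltr01)// -ler_sqr ?nnegrE// !real_normK ?num_real.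
by rewrite ler_norml => /andP[]; lra.
Qed.

(** By [sonin_ge], one point where [u] is large bounds the value at [pi / 2] from below. At
    [t = 1 / (2 N)], [y_ge] still gives [y t >= 1/2], so [u t ^+ 2 >= t / 8]; multiplying by [N^2]
    gives [N / 16]. *)
Let S0_ge : N / 16 <= v (pi / 2) ^+ 2 +
  (N ^+ 2 + (4 * sin (pi / 2) ^+ 2)^-1) * u (pi / 2) ^+ 2.
Proof.
have N0 : 0 < N by exact: lt_trans ltr01 N_gt1.
pose t := (2 * N)^-1.
have t_gt0 : 0 < t by rewrite invr_gt0 mulr_gt0.
have N1 := N_gt1.
have t_le : t <= 1 / 2 by rewrite div1r /t lef_pV2 ?posrE ?mulr_gt0//; lra.
have tp : t <= pi / 2 by apply: le_trans (pihalf_ge1 R); lra.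
have := sonin_ge N0 Du Dv (t := t); rewrite t_gt0 tp => /(_ isT).
set Q := N ^+ 2 + _; set S := (_ + _ : R) => H.
have Q0 : 0 < Q by rewrite /Q sin_pihalf ltr_pwDl ?exprn_gt0// invr_ge0; lra.
move: H; rewrite ler_pdivlMr// => H.
have st : t / 2 <= sin t by apply: sin_ge_half; rewrite ltW.
have yt : 1 / 2 <= y t.
  apply: le_trans (y_ge _); last by rewrite ltW.
  have -> : N * t = 1 / 2 by rewrite /t; field; rewrite gt_eqF.
  by lra.
have ut : t / 8 <= u t ^+ 2.
  rewrite /u exprMn sqr_sqrtr; last by lra.
  by have : 1 / 4 <= y t ^+ 2; nra.
apply: le_trans H; apply: (@le_trans _ _ (t / 8 * N ^+ 2)).
  by have -> : t / 8 * N ^+ 2 = N / 16; [rewrite /t; field; rewrite gt_eqF|].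
apply: ler_pM => //; [by lra|by rewrite sqr_ge0|].
by rewrite /Q lerDl invr_ge0 mulr_ge0// sqr_ge0.
Qed.

(** With [psi = N t - pi / 4], [(2n + 1) t = 2 psi + pi / 2], so the left-hand side is
    [|sin (2 psi)| <= 2 |cos psi|], to which [phase_at_zero] applies. At a Gauss node the weight
    formula turns the right-hand side into [16 / (n^2 w_k)]. *)
Lemma legendre_root_cos (t : R) : 0 < t <= pi / 2 -> L.[cos t] = 0 ->
  `|cos (n.*2.+1%:R * t)| <=
    8 / n%:R ^+ 2 * ((1 - cos t ^+ 2) * L^`().[cos t] ^+ 2).
Proof.
move=> tI Lt0.
have N0 : 0 < N by exact: lt_trans ltr01 N_gt1.
have ut0 : u t = 0 by rewrite /u /y Lt0 mulr0.
have N16 : 0 < N / 16 by rewrite divr_gt0.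
have [v2 H] := phase_at_zero N0 Du Dv W_pihalf tI ut0 N16 S0_ge.
have sp : 0 < sin t.
  apply: sin_gt0_pi; case/andP: tI => t0 tp; rewrite t0 (le_lt_trans tp)//.
  by have := pi_gt0 R; lra.
have vE : v t ^+ 2 = sin t * ((1 - cos t ^+ 2) * L^`().[cos t] ^+ 2).
  rewrite /v /y Lt0 mulr0 addr0 exprMn sqr_sqrtr ?ltW// /y1.
  have -> : 1 - cos t ^+ 2 = sin t ^+ 2 by rewrite -(cos2Dsin2 t); ring.
  by ring.
have dbl : `|cos (n.*2.+1%:R * t)| <= 2 * `|cos (N * t - pi / 4)|.
  have -> : n.*2.+1%:R * t = (N * t - pi / 4) *+ 2 + pi / 2.
    by rewrite /N -natr1 -muln2 natrM -mulr_natr; field.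
  rewrite cosDpihalf normrN sin_mulr2n normrMn normrM -[X in X <= _]mulr_natl ler_pM2l//.
  by rewrite ler_piMr// ler_norml sin_geN1 sin_le1.
apply: le_trans dbl _; move: H vE v2; set c := `|cos _|; set A := _ * _ ^+ 2.
move=> H vE; rewrite vE pmulr_rgt0// => A0.
have n0 : 0 < n%:R :> R by rewrite ltr0n.
have E1 : sin t / v t ^+ 2 = A^-1 by rewrite vE invfM mulrA divff ?mul1r// gt_eqF.
move: H; rewrite E1 ler_pdivrMr// => H.
rewrite [8 / _ * A]mulrC.
apply: le_trans (_ : 2 * (4 * N * (N / 16))^-1 * A <= _).
  by rewrite -[leRHS]mulrA ler_pM2l.
rewrite [_ * A]mulrC ler_pM2l//.
have -> : 2 * (4 * N * (N / 16))^-1 = 8 / N ^+ 2 by field; rewrite gt_eqF.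
rewrite ler_pM2l// lef_pV2 ?posrE ?exprn_gt0//.
by rewrite lerXn2r ?nnegrE ?ltW// /N; lra.
Qed.

End LegendreOscillation.

(** * Derivatives and integrals of Chebyshev polynomials *)

Section ChebyshevIntegral.
Context {R : realType}.
Implicit Types m n : nat.
Notation T m := (chebyshevT R m).

Lemma chebyshevTSS m : T m.+2 = 2 *: ('X * T m.+1) - T m.
Proof. by []. Qed.

Lemma size_chebyshevT m : (size (T m) <= m.+1)%N.
Proof.
elim/ltn_ind: m => -[|[|m]] IH; first by rewrite size_poly1.
  by rewrite size_polyX.
rewrite chebyshevTSS (leq_trans (size_polyD _ _))// geq_max size_polyN.
apply/andP; split; last by rewrite (leq_trans (IH m _))// ltnW.
rewrite (leq_trans (size_scale_leq _ _))// (leq_trans (size_polyMleq _ _))//.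
by rewrite size_polyX add2n -pred_Sn ltnS IH.
Qed.

(** Polynomial form of [T_m'(cos t) = m sin(m t) / sin t]; the identities go together because the
    recurrence for [T] has order two. *)
Lemma deriv_chebyshevT m :
  (1 - 'X^2) * (T m)^`() = m%:R * ('X * T m - T m.+1) /\
  (1 - 'X^2) * (T m.+1)^`() = m.+1%:R * (T m - 'X * T m.+1).
Proof.
elim: m => [|m [IH1 IH2]].
  by rewrite /= -polyC1 derivC derivX mulr0 polyC1; split; ring.
rewrite chebyshevTSS; split.
  by rewrite IH2 -mul_polyC -[2%:P]/(2%:R%:P) polyC_natr; ring.
rewrite derivB derivZ derivM derivX -mul_polyC -[2%:P]/(2%:R%:P) polyC_natr.
have -> : (1 - 'X^2) * (2%:R * (1 * T m.+1 + 'X * (T m.+1)^`()) - (T m)^`()) =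
    2%:R * (1 - 'X^2) * T m.+1 + 2%:R * 'X * ((1 - 'X^2) * (T m.+1)^`())
    - (1 - 'X^2) * (T m)^`() by ring.
by rewrite IH1 IH2 -mul_polyC -[2%:P]/(2%:R%:P) polyC_natr
  -!(natr1 m.+1) -!(natr1 m); ring.
Qed.

(** By parts, the integral of [(1 - X^2) T_{m+1}'] is twice that of [X T_{m+1}]; the two expressions
    for this derivative eliminate the latter integral. *)
Lemma pint_chebyshevT_rec m :
  (m + 3)%:R * pint (T m.+2) = (m%:R - 1) * pint (T m).
Proof.
have nat_pint (k : nat) p : pint (k%:R * p) = k%:R * pint p.
  by rewrite -polyC_natr mul_polyC pintZ.
have parts p : pint ((1 - 'X^2) * p^`()) = 2 * pint ('X * p).
  rewrite mulrC pint_parts !hornerM -polyC1 !(hornerD, hornerN, hornerXn, hornerC).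
  have -> : p * (1%:P - 'X^2)^`() = - (2%:R * ('X * p)).
    rewrite derivB derivC derivXn /= expr1 -mulr_natl; ring.
  by rewrite pintN nat_pint; ring.
have [_ /(congr1 pint) E2] := deriv_chebyshevT m.
have [/(congr1 pint) E1 _] := deriv_chebyshevT m.+1.
rewrite parts nat_pint pintD pintN in E1.
rewrite parts nat_pint pintD pintN in E2.
move: E1 E2; move: (pint (T m.+2)) (pint (T m)) (pint _) => c a b.
have m1 : m.+1%:R != 0 :> R by rewrite pnatr_eq0.
rewrite natrD => E1 E2; apply: (mulfI m1); move: E1 E2; rewrite -(natr1 m) => E1 E2.
have -> : (m%:R + 1) * ((m%:R + 3) * c) = (m%:R + 3) * ((m%:R + 1) * c) by ring.
have -> : (m%:R + 1) * c = (m%:R - 1) * b by lra.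
have -> : (m%:R + 3) * ((m%:R - 1) * b) = (m%:R - 1) * ((m%:R + 3) * b) by ring.
have -> : (m%:R + 3) * b = (m%:R + 1) * a by lra.
by ring.
Qed.

(** A substitute for [1 / z^2] that is finite at 0; real arguments allow signed differences of
    degrees. *)
Definition csq (z : R) : R := (1 + z ^+ 2)^-1.

Lemma csq_gt0 z : 0 < csq z.
Proof. by rewrite invr_gt0 ltr_pwDl// sqr_ge0. Qed.

Lemma csq_le (y z : R) : 0 <= y <= z -> csq z <= csq y.
Proof.
move=> /andP[y0 yz]; rewrite /csq lef_pV2 ?posrE ?ltr_pwDl ?sqr_ge0//.
by rewrite lerD2l lerXn2r ?nnegrE ?(le_trans y0).
Qed.

Lemma pint1 : pint (1 : {poly R}) = 2.
Proof. by have := pint_deriv ('X : {poly R}); rewrite derivX !hornerX => ->; ring. Qed.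

(** From degree 4 on, the recurrence factor [(m + 1) / (m + 5)] is positive and at most the ratio of
    the two values of [csq]. *)
Lemma pint_chebyshevT_le m : `|pint (T m)| <= 4 * csq m%:R.
Proof.
have T0 : pint (T 0) = 2 by exact: pint1.
have T1 : pint (T 1) = 0.
  have := pint_deriv ('X^2 : {poly R}); rewrite derivXn /= expr1 -scaler_nat pintZ.
  by rewrite !hornerXn; lra.
elim/ltn_ind: m => -[|[|[|[|m]]]] IH.
- by rewrite T0 /csq expr0n addr0 invr1 ger0_norm; lra.
- by rewrite T1 normr0 mulr_ge0// ltW// csq_gt0.
- have := pint_chebyshevT_rec 0; rewrite T0 => H.
  have -> : pint (T 2) = - (2 / 3).
    by move: H; move: (pint (T 2)) => c; rewrite add0n => H; lra.
  have -> : csq 2%:R = 5^-1 by rewrite /csq; congr (_^-1); ring.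
  by rewrite normrN ger0_norm; lra.
- have := pint_chebyshevT_rec 1; rewrite T1 mulr0 => /eqP.
  rewrite mulf_eq0 pnatr_eq0 /= => /eqP ->.
  by rewrite normr0 mulr_ge0// ltW// csq_gt0.
have H := pint_chebyshevT_rec m.+2.
have m0 : (0 : R) <= m%:R by [].
have := IH m.+2 (ltnW (ltnSn _)).
have E : pint (T m.+4) = (m%:R + 1) / (m%:R + 5) * pint (T m.+2).
  apply: (mulfI (_ : (m.+2 + 3)%:R != 0 :> R)); first by rewrite pnatr_eq0.
  rewrite H natrD -(natr1 m.+1) -(natr1 m); field; rewrite gt_eqF//; lra.
rewrite E normrM ger0_norm; last by rewrite divr_ge0; lra.
move=> H2; apply: le_trans (_ : (m%:R + 1) / (m%:R + 5) * (4 * csq m.+2%:R) <= _).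
  by rewrite ler_wpM2l// divr_ge0; lra.
rewrite mulrCA ler_pM2l// /csq -(natr1 m.+3) -(natr1 m.+2) -(natr1 m.+1) -(natr1 m).
rewrite -mulrA -invfM ler_pdivrMr; last by nra.
rewrite [leRHS]mulrC ler_pdivlMr; last by nra.
by nra.
Qed.

End ChebyshevIntegral.

(** * Aliasing and the quadrature error of [T m] *)

Section ChebyshevErrors.
Context {R : realType}.
Notation T m := (chebyshevT R m).

(** Since [cos(2Mt + a) + cos a = 2 cos(Mt) cos(Mt + a)], one shift by [2Mt] flips the sign up to
    [2 |cos(Mt)|]; the errors of [j] shifts add up. *)
Lemma cos_alias (M t a : R) j :
  `|cos (j%:R * (2 * M) * t + a) - (-1) ^+ j * cos a| <= j%:R * (2 * `|cos (M * t)|).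
Proof.
elim: j a => [|j IH] a; first by rewrite !mul0r add0r mul1r subrr normr0.
have -> : cos (j.+1%:R * (2 * M) * t + a) - (-1) ^+ j.+1 * cos a =
  (cos (j%:R * (2 * M) * t + (2 * M * t + a)) - (-1) ^+ j * cos (2 * M * t + a))
  + (-1) ^+ j * (cos (2 * M * t + a) + cos a).
  have -> : j.+1%:R * (2 * M) * t + a = j%:R * (2 * M) * t + (2 * M * t + a).
    by rewrite -natr1; ring.
  by rewrite exprS; ring.
have -> : j.+1%:R * (2 * `|cos (M * t)|) =
    j%:R * (2 * `|cos (M * t)|) + 2 * `|cos (M * t)| by rewrite -natr1; ring.
apply: le_trans (ler_normD _ _) _; apply: lerD; first exact: IH.
rewrite normrM normrX.
rewrite normrN1 expr1n mul1r.
have -> : cos (2 * M * t + a) + cos a = 2 * (cos (M * t) * cos (M * t + a)).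
  have -> : 2 * M * t + a = M * t + (M * t + a) by ring.
  have -> : cos a = cos (M * t + a - M * t) by congr cos; ring.
  by rewrite cosB cosD; ring.
rewrite normrM ger0_norm// ler_pM2l// normrM ler_piMr//.
by rewrite ler_norml cos_geN1 cos_le1.
Qed.

Lemma gauss_cos_bound n (x w : 'I_n -> R) (k : 'I_n) : gauss x w ->
  w k * `|cos (n.*2.+1%:R * acos (x k))| <= 16 / n%:R ^+ 2.
Proof.
move=> G; have n0 : (0 < n)%N by case: (n) k => // -[].
have [xI wk wE] := gauss_weightE G k.
have [_ /(_ k)/rootP Lx _] := G.
have xI' : -1 <= x k <= 1 by case/andP: xI => *; rewrite !ltW.
have cx : cos (acos (x k)) = x k by rewrite acosK// in_itv.
have t0 : 0 < acos (x k) by apply: acos_gt0; case/andP: xI => /ltW-> ->.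
have tpi : acos (x k) < pi by apply: acos_ltpi; case/andP: xI => -> /ltW->.
suff H : `|cos (n.*2.+1%:R * acos (x k))| <=
    8 / n%:R ^+ 2 * ((1 - x k ^+ 2) * (legendre R n)^`().[x k] ^+ 2).
  have -> : 16 / n%:R ^+ 2 = 8 / n%:R ^+ 2 * 2 :> R by ring.
  by have := ler_wpM2l (ltW wk) H; rewrite [leRHS]mulrCA wE.
have [tp|tp] := leP (acos (x k)) (pi / 2).
  by have := legendre_root_cos n0 (t := acos (x k)); rewrite t0 tp cx; exact.
(* Nodes with angle beyond [pi / 2] are reflected; parity of the Legendre polynomial and oddness of
   [2n + 1] preserve absolute values. *)
have := legendre_root_cos n0 (t := pi - acos (x k)).
have -> : cos (pi - acos (x k)) = - x k by rewrite cosB cospi sinpi cx; ring.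
have -> : cos (n.*2.+1%:R * (pi - acos (x k))) = - cos (n.*2.+1%:R * acos (x k)).
  have -> : n.*2.+1%:R * (pi - acos (x k)) =
    n.*2.+1%:R * pi + - (n.*2.+1%:R * acos (x k)) by ring.
  by rewrite cosDnatpi cosN exprS -muln2 exprM sqrr_sign; ring.
rewrite normrN legendreN Lx mulr0 deriv_legendreN sqrrN exprMn sqrrN.
rewrite sqrr_sign mul1r => -> //.
by apply/andP; split; lra.
Qed.

Section Node.
Variables (n : nat) (x w : 'I_n -> R).
Hypothesis xI : forall k, -1 <= x k <= 1.

Lemma chebyshevT_acos m k : (T m).[x k] = cos (m%:R * acos (x k)).
Proof. by rewrite -chebyshevT_cos acosK// in_itv /= xI. Qed.

Lemma interpolatory_chebyshevT m : interpolatory x w -> (m < n)%N ->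
  \sum_(k < n) w k * (T m).[x k] = pint (T m).
Proof.
move=> int mn; apply/eqP; rewrite eq_sym -subr_eq0; apply/eqP/int.
exact: leq_trans (size_chebyshevT _) mn.
Qed.

End Node.

Lemma quad_error_horner n (x w : 'I_n -> R) p :
  quad_error x w (horner p) = pint p - \sum_(k < n) w k * p.[x k].
Proof. by []. Qed.

(** The alias of [m] is whichever of [i] and [M - i] is seen to be below [n]; keeping both terms
    spares later sums the case distinction. As the alias is at most [m], the integrals of [T_m] and
    of its alias together give the factor 8. *)
Lemma clenshaw_curtis_chebyshevT n (x w : 'I_n -> R) m :
  (2 <= n)%N -> clenshaw_curtis x w -> (n <= m)%N ->
  `|quad_error x w (horner (T m))| <=
    8 * (csq (m %% (n.-1 * 2))%:R + csq (n.-1 * 2 - m %% (n.-1 * 2))%:R).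
Proof.
move=> n2 [xE int] nm; set M := (n.-1 * 2)%N; set i := (m %% M)%N.
have M0 : (0 < M)%N by rewrite /M; lia.
have iM : (i < M)%N by rewrite ltn_mod.
have im : (i <= m)%N by exact: leq_mod.
have xI k : -1 <= x k <= 1 by rewrite xE cos_geN1 cos_le1.
have key r : (r < n)%N -> (r <= m)%N ->
    (forall k : 'I_n, (T m).[x k] = (T r).[x k]) ->
    `|quad_error x w (horner (T m))| <= 8 * csq r%:R.
  move=> rn rm E; rewrite quad_error_horner.
  under eq_bigr do rewrite E.
  rewrite interpolatory_chebyshevT// (le_trans (ler_normB _ _))//.
  have := pint_chebyshevT_le (R := R) m; have := pint_chebyshevT_le (R := R) r.
  have : csq (m%:R : R) <= csq r%:R by rewrite csq_le// ler0n ler_nat.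
  lra.
have mE : m = (m %/ M * M + i)%N by exact: divn_eq.
have n1 : n.-1%:R != 0 :> R by rewrite pnatr_eq0; lia.
have := csq_gt0 (i%:R : R); have := csq_gt0 ((M - i)%:R : R).
have [iL|iL] := ltnP i n.
  suff : `|quad_error x w (horner (T m))| <= 8 * csq i%:R by lra.
  apply: key => // k; rewrite xE !chebyshevT_cos mE natrD mulrDl.
  have -> : (m %/ M * M)%:R * (k%:R / n.-1%:R * pi) = (m %/ M * k * 2)%:R * pi :> R.
    by rewrite /M !natrM; field.
  by rewrite cosDnatpi exprM sqrr_sign mul1r.
suff : `|quad_error x w (horner (T m))| <= 8 * csq (M - i)%:R by lra.
apply: key; [rewrite /M; lia|rewrite /M; lia|].
move=> k; rewrite xE !chebyshevT_cos mE.
have -> : (m %/ M * M + i)%:R * (k%:R / n.-1%:R * pi) =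
    ((m %/ M).+1 * k * 2)%:R * pi + - ((M - i)%:R * (k%:R / n.-1%:R * pi)) :> R.
  by rewrite (natrB _ (ltnW iM)) natrD /M !natrM -(natr1 (_ %/ _)); field.
by rewrite cosDnatpi exprM sqrr_sign mul1r cosN.
Qed.

Lemma gauss_alias n (x w : 'I_n -> R) (a : R) j : (0 < n)%N -> gauss x w ->
  `|\sum_(k < n) w k * cos (j%:R * (2 * n.*2.+1%:R) * acos (x k) + a * acos (x k))
    - (-1) ^+ j * \sum_(k < n) w k * cos (a * acos (x k))| <= 32 * j%:R / n%:R.
Proof.
move=> n0 G; have nR : 0 < n%:R :> R by rewrite ltr0n.
rewrite mulr_sumr -sumrB (le_trans (ler_norm_sum _ _ _))//.
apply: (@le_trans _ _ (\sum_(k < n) 32 * j%:R / n%:R ^+ 2)); last first.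
  rewrite sumr_const card_ord -mulr_natr le_eqVlt; apply/orP; left; apply/eqP.
  by field; rewrite gt_eqF.
apply: ler_sum => k _.
have [_ wk _] := gauss_weightE G k.
have -> : w k * cos (j%:R * (2 * n.*2.+1%:R) * acos (x k) + a * acos (x k))
    - (-1) ^+ j * (w k * cos (a * acos (x k))) =
  w k * (cos (j%:R * (2 * n.*2.+1%:R) * acos (x k) + a * acos (x k))
    - (-1) ^+ j * cos (a * acos (x k))) by ring.
rewrite normrM gtr0_norm//.
apply: le_trans (_ : w k * (j%:R * (2 * `|cos (n.*2.+1%:R * acos (x k))|)) <= _).
  by rewrite ler_pM2l// cos_alias.
have H := gauss_cos_bound k G.
have -> : w k * (j%:R * (2 * `|cos (n.*2.+1%:R * acos (x k))|)) =
  2 * j%:R * (w k * `|cos (n.*2.+1%:R * acos (x k))|) by ring.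
have -> : 32 * j%:R / n%:R ^+ 2 = 2 * j%:R * (16 / n%:R ^+ 2) :> R by ring.
by rewrite ler_wpM2l// mulr_ge0.
Qed.

(** The bound 6 is 4 for the integral plus the total weight 2. In the aliasing bound the third [csq]
    term serves the residues next to [2n + 1], whose aliases have degree beyond [2n - 1]. *)
Lemma gauss_chebyshevT n (x w : 'I_n -> R) m :
  (0 < n)%N -> gauss x w -> (n <= m)%N ->
  let i := (m %% (n.*2.+1 * 2))%N in
  `|quad_error x w (horner (T m))| <= 6 /\
  `|quad_error x w (horner (T m))| <=
    16 * (csq i%:R + csq ((n.*2.+1 * 2) - i)%:R + csq (i%:R - n.*2.+1%:R))
    + 48 * (m%:R / n%:R ^+ 2).
Proof.
move=> n0 G nm; set M := (n.*2.+1 * 2)%N => i.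
have M0 : (0 < M)%N by rewrite /M; lia.
have iM : (i < M)%N by rewrite ltn_mod.
have im : (i <= m)%N by exact: leq_mod.
have nR : 0 < n%:R :> R by rewrite ltr0n.
have mE : m = (m %/ M * M + i)%N by exact: divn_eq.
have [_ _ int] := G.
have xI k : -1 <= x k <= 1.
  by have [/andP[? ?] _ _] := gauss_weightE G k; rewrite !ltW.
have sumw : \sum_(k < n) w k = 2.
  rewrite -(pint1 (R := R)) -[1 : {poly R}]/(T 0) -(interpolatory_chebyshevT int n0).
  by apply: eq_bigr => k _; rewrite /= hornerC mulr1.
have E6 : `|quad_error x w (horner (T m))| <= 6.
  rewrite quad_error_horner (le_trans (ler_normB _ _))//.
  have -> : 6 = 4 + 2 :> R by ring.
  apply: lerD.
    apply: le_trans (pint_chebyshevT_le m) _.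
    by rewrite ler_piMr// /csq invf_le1 ?ltr_pwDl ?sqr_ge0// lerDl sqr_ge0.
  rewrite (le_trans (ler_norm_sum _ _ _))// -sumw ler_sum// => k _.
  have [_ wk _] := gauss_weightE G k.
  rewrite normrM gtr0_norm// ler_piMr ?(ltW wk)// chebyshevT_acos//.
  by rewrite ler_norml cos_geN1 cos_le1.
split=> //.
have mn0 : 0 <= m%:R / n%:R ^+ 2 :> R by rewrite divr_ge0// sqr_ge0.
have c1 := csq_gt0 (i%:R : R); have c2 := csq_gt0 ((M - i)%:R : R).
have c3 := csq_gt0 (i%:R - n.*2.+1%:R : R).
(* Here [a] is [r] or [-r], one sign for each side of a multiple of the period;
   [j * (n * 2) <= 3 * m] turns the aliasing error [32 j / n] into [48 m / n^2]. *)
have key r j (a : R) : (r < n.*2)%N -> (r <= m)%N -> (j * (n * 2) <= 3 * m)%N ->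
    `|a| = r%:R -> m%:R = j%:R * (2 * n.*2.+1%:R) + a ->
    `|quad_error x w (horner (T m))| <= 8 * csq r%:R + 48 * (m%:R / n%:R ^+ 2).
  move=> rn rm jm ar ma; rewrite quad_error_horner.
  have rE k : cos (a * acos (x k)) = (T r).[x k].
    rewrite chebyshevT_acos// -ar; have [_|_] := ger0P a => //.
    by rewrite mulNr cosN.
  have Tr : \sum_(k < n) w k * cos (a * acos (x k)) = pint (T r).
    rewrite (gauss_exact G); last first.
      by rewrite (leq_trans (size_chebyshevT _))// addnn.
    by apply: eq_bigr => k _; rewrite rE.
  have := gauss_alias a j n0 G; rewrite Tr.
  have -> : \sum_(k < n) w k * cos (j%:R * (2 * n.*2.+1%:R) * acos (x k) + a * acos (x k))
      = \sum_(k < n) w k * (T m).[x k].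
    apply: eq_bigr => k _; rewrite chebyshevT_acos// ma. by congr (_ * cos _); ring.
  move=> A.
  have jn : 32 * j%:R / n%:R <= 48 * (m%:R / n%:R ^+ 2) :> R.
    rewrite mulrA ler_pdivrMr// expr2 invfM mulrA divfK ?gt_eqF//.
    rewrite ler_pdivlMr//.
    have : (j * (n * 2))%:R <= (3 * m)%:R :> R by rewrite ler_nat.
    by rewrite !natrM; nra.
  have := pint_chebyshevT_le (R := R) m; have := pint_chebyshevT_le (R := R) r.
  have : csq (m%:R : R) <= csq r%:R by rewrite csq_le// ler0n ler_nat.
  move: A jn; set S := \sum_(_ < n) _; set d := 32 * _ / _; set e := _ / _ => A jn.
  have -> : pint (T m) - S = pint (T m) - (-1) ^+ j * pint (T r)
    - (S - (-1) ^+ j * pint (T r)) by ring.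
  move=> h1 h2 h3; rewrite (le_trans (ler_normB _ _))//.
  have : `|pint (T m) - (-1) ^+ j * pint (T r)| <= 8 * csq r%:R.
    rewrite (le_trans (ler_normB _ _))// normrM normrX normrN1 expr1n mul1r.
    by lra.
  by lra.
have [i1|i1] := ltnP i n.*2.
  suff : `|quad_error x w (horner (T m))| <= 8 * csq i%:R + 48 * (m%:R / n%:R ^+ 2) by lra.
  apply: (key i (m %/ M)%N i%:R) => //.
  - rewrite [X in (_ <= 3 * X)%N]mE; move: (m %/ M)%N => q; rewrite /M; nia.
  - by rewrite normr_nat.
  - by rewrite {1}mE natrD natrM /M natrM [_ * 2]mulrC.
have [i2|i2] := leqP i n.*2.+2; last first.
  suff : `|quad_error x w (horner (T m))| <= 8 * csq (M - i)%:R + 48 * (m%:R / n%:R ^+ 2) by lra.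
  apply: (key (M - i)%N (m %/ M).+1 (- (M - i)%:R)).
  - by rewrite /M; lia.
  - by rewrite /M; lia.
  - rewrite [X in (_ <= 3 * X)%N]mE; move: (m %/ M)%N => q; rewrite /M; nia.
  - by rewrite normrN normr_nat.
  - by rewrite {1}mE (natrB _ (ltnW iM)) natrD natrM -(natr1 (_ %/ _)) /M !natrM; ring.
(* Only the residues [2n], [2n + 1] and [2n + 2] remain, and there 16 times this term exceeds 6. *)
have : 1 / 2 <= csq (i%:R - n.*2.+1%:R : R).
  rewrite div1r /csq lef_pV2 ?posrE ?ltr_pwDl ?sqr_ge0//.
  have : n.*2.+1%:R <= i.+1%:R :> R by rewrite ler_nat.
  have : i%:R <= n.*2.+2%:R :> R by rewrite ler_nat.
  by rewrite -(natr1 i) -(natr1 n.*2.+1); nra.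
lra.
Qed.

End ChebyshevErrors.

(** * Power sums over tails and over periodic blocks *)

Section Sums.
Context {R : realType}.

(** This makes the tail telescope. For [q = m / (m + 1)], [ln q <= - 1 / (m + 1)] gives
    [q^b <= 1 / (1 + b / (m + 1))]; the constant comes from [m + 1 + b <= 2 (1 + b) m]. *)
Lemma powR_tail_step (b : R) m : 0 < b -> (0 < m)%N ->
  m%:R `^ (- b - 1) <= 2 * (1 + b) / b * (m%:R `^ (- b) - m.+1%:R `^ (- b)).
Proof.
move=> b0 m0; have mR : 1 <= m%:R :> R by rewrite ler1n.
have m_gt0 : 0 < m%:R :> R by rewrite ltr0n.
pose q : R := m%:R / m.+1%:R.
have q_gt0 : 0 < q by rewrite divr_gt0.
have qE : m.+1%:R = m%:R * q^-1 :> R by rewrite /q invf_div mulrC divfK ?gt_eqF.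
have lnq : ln q <= - m.+1%:R^-1.
  have -> : q = 1 + - m.+1%:R^-1 by rewrite /q -(natr1 m); field; lra.
  by apply: le_ln1Dx; rewrite ltrN2 invf_lt1 ?ltr1n.
have qb : q `^ b <= (1 + b / m.+1%:R)^-1.
  have t0 : 0 < 1 + b / m.+1%:R by rewrite ltr_pwDl// divr_ge0// ltW.
  rewrite -[q `^ b]invrK lef_pV2 ?posrE ?invr_gt0 ?powR_gt0//.
  rewrite -powRN /powR gt_eqF// (le_trans (expR_ge1Dx _))// ler_expR.
  by rewrite mulNr -mulrN ler_pM2l// lerNr.
have -> : m.+1%:R `^ (- b) = m%:R `^ (- b) * q `^ b.
  rewrite qE powRM ?invr_ge0 ?ltW//; congr (_ * _).
  by rewrite -(powR_inv1 (ltW q_gt0)) -powRrM mulrNN mul1r.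
have -> : m%:R `^ (- b - 1) = m%:R `^ (- b) * m%:R^-1.
  rewrite powRD; last by rewrite (gt_eqF m_gt0) implybT.
  by rewrite powR_inv1// ltW.
have -> : 2 * (1 + b) / b * (m%:R `^ (- b) - m%:R `^ (- b) * q `^ b) =
  m%:R `^ (- b) * (2 * (1 + b) / b * (1 - q `^ b)) by ring.
rewrite ler_pM2l ?powR_gt0//.
apply: le_trans (_ : 2 * (1 + b) / b * (1 - (1 + b / m.+1%:R)^-1) <= _); last first.
  by rewrite ler_pM2l ?lerD2l ?lerN2// divr_gt0 ?mulr_gt0//; lra.
have -> : 2 * (1 + b) / b * (1 - (1 + b / m.+1%:R)^-1) =
    2 * (1 + b) / (m%:R + 1 + b).
  rewrite -(natr1 m); field; apply/and3P; split; lra.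
rewrite -[leLHS]mul1r ler_pdivrMr// mulrAC ler_pdivlMr; last by lra.
by nra.
Qed.

Lemma powR_tail (b : R) : 0 < b -> exists2 C : R, 0 < C &
  forall n K, (0 < n)%N -> \sum_(n <= m < K) m%:R `^ (- b - 1) <= C * n%:R `^ (- b).
Proof.
move=> b0; exists (2 * (1 + b) / b); first by rewrite divr_gt0 ?mulr_gt0//; lra.
move=> n K n0; have C0 : 0 <= 2 * (1 + b) / b by rewrite divr_ge0 ?mulr_ge0; lra.
have [Kn|nK] := leqP K n; first by rewrite big_geq// mulr_ge0// powR_ge0.
apply: le_trans (_ : 2 * (1 + b) / b * (n%:R `^ (- b) - K%:R `^ (- b)) <= _); last first.
  by rewrite ler_wpM2l// gerBl powR_ge0.
rewrite -[n%:R `^ _ - _]opprB -(telescope_sumr (fun m => m%:R `^ (- b))) ?(ltnW nK)//.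
rewrite -sumrN mulr_sumr; apply: ler_sum_nat => m /andP[nm _].
by rewrite opprB; apply: powR_tail_step => //; exact: leq_trans nm.
Qed.

Lemma sum_divn_modn (G b : nat -> R) M K : (0 < M)%N ->
  \sum_(0 <= m < K * M) G (m %/ M)%N * b (m %% M)%N =
  (\sum_(0 <= j < K) G j) * \sum_(0 <= i < M) b i.
Proof.
move=> M0; elim: K => [|K IH]; first by rewrite mul0n /index_iota !big_nil mul0r.
rewrite mulSn addnC (@big_cat_nat _ _ _ (K * M)) ?leq_addr//= IH.
rewrite -{1}[(K * M)%N]add0n big_addn addKn big_nat_recr//= mulrDl.
congr (_ + _); rewrite mulr_sumr; apply: eq_big_nat => i /andP[_ iM].
by rewrite addnC divnMDl// divn_small// addn0 modnMDl modn_small.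
Qed.

(** Cut the range into blocks of length [M]: in block [j] the power is [O((n (j + 1))^(-s-1))], the
    values of [b] sum to at most [B], and the series over [j] converges. *)
Lemma powR_block (s : R) : 0 < s -> exists2 C : R, 0 < C &
  forall n M K (b : nat -> R) (B : R), (0 < n)%N -> (n <= M <= 6 * n)%N ->
  (forall i, 0 <= b i) -> \sum_(0 <= i < M) b i <= B ->
  \sum_(n <= m < K) m%:R `^ (- s - 1) * b (m %% M)%N <= C * B * n%:R `^ (- s - 1).
Proof.
move=> s0; have [C C0 tail] := powR_tail s0.
exists (7 `^ (s + 1) * C); first by rewrite mulr_gt0// powR_gt0.
move=> n M K b B n0 /andP[nM Mn] b0 sumB.
have M0 : (0 < M)%N by exact: leq_trans nM.
have B0 : 0 <= B by apply: le_trans sumB; rewrite sumr_ge0.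
pose G j : R := 7 `^ (s + 1) * n%:R `^ (- s - 1) * j.+1%:R `^ (- s - 1).
have G0 j : 0 <= G j by rewrite !mulr_ge0 ?powR_ge0.
apply: le_trans (_ : \sum_(n <= m < K) G (m %/ M)%N * b (m %% M)%N <= _).
  apply: ler_sum_nat => m /andP[nm mK]; apply: ler_wpM2r => //.
  have m0 : 0 < m%:R :> R by rewrite ltr0n (leq_trans n0).
  have nR : 0 < n%:R :> R by rewrite ltr0n.
  (* With [j = m %/ M], this follows from [n <= m] and [j n <= j M <= m]. *)
  have le7 : n%:R * (m %/ M).+1%:R <= 7 * m%:R :> R.
    rewrite -!natrM ler_nat; have := leq_divM m M.
    by move: (m %/ M)%N => j; nia.
  have -> : G (m %/ M)%N = (n%:R * (m %/ M).+1%:R / 7) `^ (- s - 1).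
    rewrite !powRM ?invr_ge0 ?mulr_ge0// -(powR_inv1 (_ : 0 <= 7))// -powRrM /G.
    have -> : -1 * (- s - 1) = s + 1 by ring.
    by ring.
  have -> : - s - 1 = - (s + 1) by ring.
  rewrite !powRN lef_pV2 ?posrE ?powR_gt0 ?divr_gt0 ?mulr_gt0//.
  apply: ge0_ler_powR.
  - by lra.
  - by rewrite nnegrE divr_ge0// mulr_ge0.
  - by rewrite nnegrE ltW.
  - by rewrite ler_pdivrMr// [_ * 7]mulrC.
(* Nonnegative terms fill up [K] whole blocks. *)
apply: le_trans (_ : \sum_(0 <= m < K * M) G (m %/ M)%N * b (m %% M)%N <= _).
  have GB m : 0 <= G (m %/ M)%N * b (m %% M)%N by exact: mulr_ge0.
  have [Kn|nK] := leqP K n; first by rewrite big_geq// sumr_ge0.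
  rewrite [leRHS](@big_cat_nat _ _ _ n)//=; last first.
    by rewrite (leq_trans (ltnW nK))// leq_pmulr.
  rewrite [X in _ <= _ + X](@big_cat_nat _ _ _ K) ?leq_pmulr ?(ltnW nK)//=.
  by rewrite addrCA lerDl addr_ge0// sumr_ge0.
rewrite sum_divn_modn// /G -mulr_sumr.
have -> : 7 `^ (s + 1) * C * B * n%:R `^ (- s - 1) =
  7 `^ (s + 1) * n%:R `^ (- s - 1) * C * B by ring.
apply: ler_pM => //; [|by rewrite sumr_ge0|].
  by rewrite mulr_ge0 ?mulr_ge0 ?powR_ge0// sumr_ge0// => j _; rewrite powR_ge0.
rewrite ler_wpM2l ?mulr_ge0 ?powR_ge0//.
have := tail 1%N K.+1 isT; rewrite powR1 mulr1 big_add1 /=; exact.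
Qed.

(** The increasing function [phi] stays between -1 and 1, and a unit step raises it by at least
    [csq t / 6]; hence 12, uniformly in [z] and [M]. *)
Lemma sum_csq (z : R) M : \sum_(0 <= i < M) csq (i%:R + z) <= 12.
Proof.
pose phi (t : R) := t / (1 + `|t|).
have d0 (t : R) : 0 < 1 + `|t| by rewrite ltr_pwDl.
have phi1 t : `|phi t| <= 1.
  by rewrite /phi normrM normfV (gtr0_norm (d0 t)) ler_pdivrMr// mul1r lerDr.
have step t : csq t <= 6 * (phi (t + 1) - phi t).
  have frac (a c : R) : 0 < a -> 0 < c -> c <= 6 * a -> a^-1 <= 6 / c.
    by move=> a0 c0 ca; rewrite ler_pdivlMr// mulrC ler_pdivrMr.
  rewrite /csq /phi; have [t0|t0] := leP 0 t.
    rewrite !ger0_norm; [|lra|lra].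
    have -> : 6 * ((t + 1) / (1 + (t + 1)) - t / (1 + t)) = 6 / ((1 + t) * (2 + t)).
      by field; apply/andP; split; lra.
    by apply: frac; nra.
  rewrite (ltr0_norm t0); have [t1|t1] := leP 0 (t + 1).
    rewrite (ger0_norm t1).
    apply: (@le_trans _ _ 1); first by rewrite invf_le1 ?ltr_pwDl ?sqr_ge0// lerDl sqr_ge0.
    have h1 : (t + 1) / 2 <= (t + 1) / (1 + (t + 1)).
      by rewrite ler_wpM2l// lef_pV2 ?posrE; lra.
    have h2 : - t / 2 <= - t / (1 + - t) by rewrite ler_wpM2l ?lef_pV2 ?posrE; lra.
    by rewrite mulNr in h2; lra.
  rewrite (ltr0_norm t1).
  have -> : 6 * ((t + 1) / (1 + - (t + 1)) - t / (1 + - t)) = 6 / (- t * (1 - t)).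
    by field; apply/and3P; split; lra.
  by apply: frac; nra.
apply: (@le_trans _ _ (6 * (phi (M%:R + z) - phi z))); last first.
  have := phi1 (M%:R + z); have := phi1 z; rewrite !ler_norml => /andP[? ?] /andP[? ?].
  lra.
elim: M => [|M IH]; first by rewrite big_geq// add0r subrr mulr0.
rewrite big_nat_recr//=; have := step (M%:R + z).
have -> : M%:R + z + 1 = M.+1%:R + z by rewrite -(natr1 M); ring.
lra.
Qed.

End Sums.

(** * From partial sums of the Chebyshev expansion to [f] *)

Section Expansion.
Context {R : realType}.
Notation T m := (chebyshevT R m).
Implicit Types (f : R -> R) (a : nat -> R).

Definition chebyshev_sum a K : {poly R} :=
  (a 0 / 2)%:P + \sum_(1 <= m < K) a m *: T m.

Lemma horner_chebyshev_sum a K x :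
  (chebyshev_sum a K).[x] = a 0 / 2 + \sum_(1 <= m < K) a m * (T m).[x].
Proof.
rewrite /chebyshev_sum hornerD hornerC horner_sum; congr (_ + _).
by apply: eq_bigr => m _; rewrite hornerZ.
Qed.

Lemma quad_error_chebyshev_sum n (x w : 'I_n -> R) a K : (0 < n)%N ->
  (forall m, (m < n)%N -> quad_error x w (horner (T m)) = 0) -> (n <= K)%N ->
  quad_error x w (horner (chebyshev_sum a K)) =
  \sum_(n <= m < K) a m * quad_error x w (horner (T m)).
Proof.
move=> n0 ex nK.
have Q0 : quad_error x w (horner (0 : {poly R})) = 0.
  rewrite quad_error_horner -(scale0r 0) pintZ mul0r sub0r big1 ?oppr0// => k _.
  by rewrite scale0r horner0 mulr0.
have QD p q : quad_error x w (horner (p + q)) =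
    quad_error x w (horner p) + quad_error x w (horner q).
  rewrite !quad_error_horner pintD addrACA -opprD -big_split /=.
  by congr (_ - _); apply: eq_bigr => k _; rewrite hornerD mulrDr.
have QZ c p : quad_error x w (horner (c *: p)) = c * quad_error x w (horner p).
  rewrite !quad_error_horner pintZ mulrBr mulr_sumr; congr (_ - _).
  by apply: eq_bigr => k _; rewrite hornerZ mulrCA.
rewrite /chebyshev_sum QD -[_%:P]mulr1 mul_polyC QZ (ex 0 n0) mulr0 add0r.
rewrite (big_morph (fun p => quad_error x w (horner p)) QD Q0).
rewrite (@big_cat_nat _ _ _ n)//= big_nat big1 ?add0r => [|m /andP[_ mn]].
  by apply: eq_bigr => m _; rewrite QZ.
by rewrite QZ ex// mulr0.
Qed.

(** Partial sums obey the bound by linearity and exactness below degree [n]; the limit is taken by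
    dominated convergence in the integral and pointwise in the rule. *)
Lemma quad_error_le n (x w : 'I_n -> R) f a (G B : R) : (0 < n)%N ->
  (forall k, -1 <= x k <= 1) ->
  (forall m, (m < n)%N -> quad_error x w (horner (T m)) = 0) ->
  (forall y, -1 <= y <= 1 -> (chebyshev_sum a K).[y] @[K --> \oo] --> f y) ->
  (forall K, \sum_(1 <= m < K) `|a m| <= G) ->
  (forall K, \sum_(n <= m < K) `|a m| * `|quad_error x w (horner (T m))| <= B) ->
  `|quad_error x w f| <= B.
Proof.
move=> n0 xI ex cf aG aB.
have T1 m y : -1 <= y <= 1 -> `|(T m).[y]| <= 1.
  move=> yI; rewrite -(acosK (x := y)) ?in_itv// chebyshevT_cos.
  by rewrite ler_norml cos_geN1 cos_le1.
have cint : pint (chebyshev_sum a K) @[K --> \oo] -->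
    \int[@lebesgue_measure R]_(t in `[-1, 1]) f t.
  pose D : set R := `[-1, 1]%classic.
  have mD : measurable D by exact: measurable_itv.
  pose g (t : R) : \bar R := (`|a 0 / 2| + G)%:E.
  pose fK K (t : R) : \bar R := ((chebyshev_sum a K).[t])%:E.
  have mK K : measurable_fun D (fK K).
    apply/measurable_EFinP; apply: measurable_funTS.
    by apply: continuous_measurable_fun; exact: continuous_horner.
  have cK t : D t -> fK ^~ t @ \oo --> (f t)%:E.
    rewrite /D /= in_itv /= => tI; apply: cvg_EFin; first exact: nearW.
    exact: cf.
  (* [f] is known only through its expansion, so its measurability is that of a pointwise limit of
     polynomials. *)
  have mf : measurable_fun D (EFin \o f) by exact: emeasurable_fun_cvg mK cK.
  have ig : (@lebesgue_measure R).-integrable D g.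
    apply: (@continuous_compact_integrable _ (cst (`|a 0 / 2| + G))).
      exact: segment_compact.
    by apply: continuous_subspaceT => t; exact: cvg_cst.
  have bd K t : D t -> (`|fK K t| <= g t)%E.
    rewrite /D /= in_itv /= => tI; rewrite lee_fin horner_chebyshev_sum.
    rewrite (le_trans (ler_normD _ _))// lerD2l.
    rewrite (le_trans (ler_norm_sum _ _ _))// (le_trans _ (aG K))// ler_sum// => m _.
    by rewrite normrM ler_piMr// T1.
  have [||iF _ C] := @dominated_convergence _ _ _ (@lebesgue_measure R) D mD fK
    (EFin \o f) g mK mf _ ig _.
  - by apply: aeW => t; exact: cK.
  - by apply: aeW => t K; exact: bd.
  have : (fine \o (fun K => \int[@lebesgue_measure R]_(t in D) fK K t)%E) @ \oo -->
      \int[@lebesgue_measure R]_(t in D) f t.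
    apply: fine_cvg; rewrite /Rintegral fineK; first exact: C.
    exact: integrable_fin_num.
  exact.
have csum : \sum_(k < n) w k * (chebyshev_sum a K).[x k] @[K --> \oo] -->
    \sum_(k < n) w k * f (x k).
  apply: cvg_big => [|k _].
    exact: add_continuous.
  by apply: cvgMr; exact: cf.
have cE : `|quad_error x w (horner (chebyshev_sum a K))| @[K --> \oo] -->
    `|quad_error x w f|.
  by apply: cvg_norm; exact: cvgB.
apply: cvgr_to_le cE _.
exists n => // K /= nK.
rewrite quad_error_chebyshev_sum// (le_trans (ler_norm_sum _ _ _))//.
by under eq_bigr do rewrite normrM; exact: aB.
Qed.

End Expansion.

(** * Summation of the errors and the convergence rates *)

Section Rates.
Context {R : realType} (s : R) (f : R -> R).
Hypothesis s_gt0 : 0 < s.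
Notation T m := (chebyshevT R m).

Lemma class_X_coef : class_X s f -> exists (a : nat -> R) (A G : R) (m0 : nat),
  [/\ 0 < A,
      forall y, -1 <= y <= 1 -> (chebyshev_sum a K).[y] @[K --> \oo] --> f y,
      forall K, \sum_(1 <= m < K) `|a m| <= G &
      forall m, (m0 <= m)%N -> `|a m| <= A * m%:R `^ (- s - 1)].
Proof.
case=> a [cf] /eqO_exP [A A0 [m1 _ bd]].
(* The threshold [m1.+1] is positive, as [powR_tail] requires. *)
have {}bd m : (m1.+1 <= m)%N -> `|a m| <= A * m%:R `^ (- s - 1).
  by move=> /ltnW mm; rewrite -[X in A * X]ger0_norm ?powR_ge0//; exact: bd.
have [C C0 tail] := powR_tail s_gt0.
exists a, A, (\sum_(1 <= m < m1.+1) `|a m| + A * (C * m1.+1%:R `^ (- s))), m1.+1.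
split=> // [y yI|K].
  by under eq_fun do rewrite horner_chebyshev_sum; exact: cf.
have [Km|mK] := leqP K m1.+1.
  case: K Km => [|K] Km; first by rewrite big_geq// addr_ge0 ?sumr_ge0// !mulr_ge0 ?powR_ge0 ?ltW.
  rewrite [X in _ <= X + _](@big_cat_nat _ _ _ K.+1)//= -addrA lerDl.
  by rewrite addr_ge0 ?sumr_ge0// !mulr_ge0 ?powR_ge0 ?ltW.
rewrite (@big_cat_nat _ _ _ m1.+1)//= ?(ltnW mK)// lerD2l.
apply: (@le_trans _ _ (\sum_(m1.+1 <= m < K) A * m%:R `^ (- s - 1))).
  by apply: ler_sum_nat => m /andP[mm _]; exact: bd.
by rewrite -mulr_sumr ler_pM2l// tail.
Qed.

Lemma csq_period_sum (M c : nat) :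
  \sum_(0 <= i < M) (csq (i%:R : R) + csq ((M - i)%:R : R) + csq (i%:R - c%:R : R)) <= 36.
Proof.
rewrite !big_split /=.
have -> : \sum_(0 <= i < M) csq ((M - i)%:R : R) = \sum_(0 <= i < M) csq (i%:R - M%:R : R).
  apply: eq_big_nat => i /andP[_ iM]; by rewrite (natrB _ (ltnW iM)) /csq -sqrrN opprB.
have := sum_csq (0 : R) M.
have -> : \sum_(0 <= i < M) csq (i%:R + 0 : R) = \sum_(0 <= i < M) csq (i%:R : R).
  by apply: eq_bigr => i _; rewrite addr0.
have := sum_csq (- M%:R : R) M; have := sum_csq (- c%:R : R) M.
lra.
Qed.

(* With [kappa = 0] this covers Clenshaw--Curtis quadrature, where aliasing is exact. *)
Lemma quad_error_rate (al kappa D : R) (M c : nat -> nat)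
    (x w : forall n : nat, 'I_n -> R) : class_X s f ->
  0 < al -> al < s -> 0 <= kappa -> 0 <= D ->
  (forall n, (2 <= n)%N -> (n <= M n <= 6 * n)%N) ->
  (forall n, (2 <= n)%N -> forall k, -1 <= x n k <= 1) ->
  (forall n, (2 <= n)%N -> interpolatory (x n) (w n)) ->
  (forall n m, (2 <= n)%N -> (n <= m)%N ->
    `|quad_error (x n) (w n) (horner (T m))| <=
    D * (csq (m %% M n)%:R + csq (M n - m %% M n)%:R + csq ((m %% M n)%:R - (c n)%:R))
    + kappa * (m%:R / n%:R ^+ 2) `^ al) ->
  exists C m0, forall n, (2 <= n)%N -> (m0 <= n)%N ->
    `|quad_error (x n) (w n) f| <=
      C * (n%:R `^ (- s - 1) + kappa * n%:R `^ (- s - al)).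
Proof.
move=> /class_X_coef[a [A [G [m0 [A0 cf aG aA]]]]] al0 als k0 D0 MI xI int ET.
have [C1 C10 block] := powR_block s_gt0.
have [C2 C20 tail] : exists2 C : R, 0 < C & forall n K, (0 < n)%N ->
    \sum_(n <= m < K) m%:R `^ (- (s - al) - 1) <= C * n%:R `^ (- (s - al)).
  by apply: powR_tail; lra.
exists (A * (D * (C1 * 36) + C2)), m0 => n n2 mn.
have n0 : (0 < n)%N by exact: leq_trans n2.
have nR : 0 < n%:R :> R by rewrite ltr0n.
apply: (@quad_error_le _ _ _ _ _ a G) => // [k|m mltn|K].
- exact: xI.
- rewrite quad_error_horner interpolatory_chebyshevT ?subrr//.
  exact: int.
pose b i : R := csq i%:R + csq (M n - i)%:R + csq (i%:R - (c n)%:R).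
have b0 i : 0 <= b i by rewrite !addr_ge0// ltW// csq_gt0.
(* The second term is [(m / n^2)^al m^(-s-1)] regrouped; since [al < s], its tail sum is
   [O(n^(-2 al) n^(-(s - al)))], that is [O(n^(-s-al))]. *)
apply: (@le_trans _ _ (\sum_(n <= m < K) (A * D * (m%:R `^ (- s - 1) * b (m %% M n)%N)
    + A * kappa * n%:R `^ (- 2 * al) * m%:R `^ (- (s - al) - 1)))).
  apply: ler_sum_nat => m /andP[nm _].
  have m_gt0 : 0 < m%:R :> R by rewrite ltr0n (leq_trans n0).
  apply: le_trans (ler_pM (normr_ge0 _) (normr_ge0 _) (aA _ (leq_trans mn nm)) (ET _ _ n2 nm)) _.
  have ni0 : 0 <= (n%:R ^+ 2)^-1 :> R by rewrite invr_ge0 exprn_ge0.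
  rewrite -/(b (m %% M n)%N) (powRM _ (ltW m_gt0) ni0).
  have -> : (n%:R ^+ 2)^-1 `^ al = n%:R `^ (- 2 * al) :> R.
    rewrite -powR_inv1 ?exprn_ge0// -powR_mulrn// -!powRrM.
    by congr (_ `^ _); ring.
  have -> : m%:R `^ (- (s - al) - 1) = m%:R `^ (- s - 1) * m%:R `^ al :> R.
    rewrite -powRD; first by congr (_ `^ _); ring.
    by rewrite (gt_eqF m_gt0) implybT.
  by rewrite le_eqVlt; apply/orP; left; apply/eqP; ring.
rewrite big_split /= -!mulr_sumr.
have B1 := block n (M n) K b 36 n0 (MI n n2) b0 (csq_period_sum _ _).
have B2 := tail n K n0.
have nE : n%:R `^ (- s - al) = n%:R `^ (- 2 * al) * n%:R `^ (- (s - al)) :> R.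
  rewrite -powRD; first by congr (_ `^ _); ring.
  by rewrite (gt_eqF nR) implybT.
rewrite nE.
apply: (@le_trans _ _ (A * D * (C1 * 36 * n%:R `^ (- s - 1)) +
   A * kappa * n%:R `^ (- 2 * al) * (C2 * n%:R `^ (- (s - al))))).
  apply: lerD; apply: ler_wpM2l => //; rewrite !mulr_ge0 ?powR_ge0// ltW//.
have p1 := powR_ge0 (n%:R : R) (- s - 1).
have p2 := powR_ge0 (n%:R : R) (- 2 * al).
have p3 := powR_ge0 (n%:R : R) (- (s - al)).
rewrite -subr_ge0.
set P1 := _ `^ _ in p1 *; set P2 := _ `^ _ in p2 *; set P3 := _ `^ _ in p3 *.
have -> : A * (D * (C1 * 36) + C2) * (P1 + kappa * (P2 * P3)) -
   (A * D * (C1 * 36 * P1) + A * kappa * P2 * (C2 * P3)) =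
   A * C2 * P1 + A * (D * (C1 * 36)) * (kappa * (P2 * P3)) by ring.
by rewrite addr_ge0// !mulr_ge0// ltW.
Qed.

Lemma bigO_of_le (E g : nat -> R) (C : R) (m0 : nat) :
  (forall n, (m0 <= n)%N -> `|E n| <= C * g n) -> E =O_\oo g.
Proof.
move=> H; apply/eqO_exP; exists (`|C| + 1); first by rewrite ltr_wpDl.
exists m0 => // n /= mn; rewrite (le_trans (H n mn))//.
rewrite (le_trans (ler_norm _))// normrM ler_wpM2r// lerDl.
exact: ler01.
Qed.

Lemma clenshaw_curtis_rate (x w : forall n : nat, 'I_n -> R) : class_X s f ->
  (forall n, (2 <= n)%N -> clenshaw_curtis (x n) (w n)) ->
  (fun n => quad_error (x n) (w n) f) =O_\oo (fun n => n%:R `^ (- s - 1)).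
Proof.
move=> fX CC.
(* With [kappa = 0], any [al] strictly between 0 and [s] serves. *)
have [||||||||C [m0 H]] := @quad_error_rate (s / 2) 0 8 (fun n => n.-1 * 2)%N
  (fun=> 0%N) x w fX.
- by rewrite divr_gt0.
- by have s0 : 0 < s := s_gt0; lra.
- by [].
- by [].
- by move=> n n2; lia.
- by move=> n n2 k; rewrite (CC n n2).1 cos_geN1 cos_le1.
- by move=> n /CC[].
- move=> n m n2 nm; rewrite mul0r addr0.
  apply: le_trans (clenshaw_curtis_chebyshevT n2 (CC n n2) nm) _.
  by rewrite ler_pM2l// lerDl ltW// csq_gt0.
apply: (@bigO_of_le _ _ C (maxn 2 m0)) => n; rewrite geq_max => /andP[n2 mn].
by have := H n n2 mn; rewrite mul0r addr0.
Qed.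

Lemma gauss_rate (al : R) (x w : forall n : nat, 'I_n -> R) : class_X s f ->
  0 < al -> al < s -> al <= 1 ->
  (forall n, (1 <= n)%N -> gauss (x n) (w n)) ->
  (fun n => quad_error (x n) (w n) f) =O_\oo (fun n => n%:R `^ (- s - al)).
Proof.
move=> fX al0 als al1 GG.
have [||||||C [m0 H]] := @quad_error_rate al 48 16 (fun n => n.*2.+1 * 2)%N
  (fun n => n.*2.+1) x w fX al0 als.
- by [].
- by [].
- by move=> n n2; lia.
- move=> n n2 k; have [/andP[? ?] _ _] := gauss_weightE (GG n (ltnW n2)) k.
  by rewrite !ltW.
- by move=> n /ltnW/GG[].
- move=> n m n2 nm.
  have [h1 h2] := gauss_chebyshevT (ltnW n2) (GG n (ltnW n2)) nm.
  have m0 : (0 : R) < m%:R by rewrite ltr0n; lia.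
  have nR : (0 : R) < n%:R by rewrite ltr0n; lia.
  set b := _ + _ + csq _ in h2 *; set t := m%:R / n%:R ^+ 2 in h2 *.
  have b0 : 0 <= b by rewrite !addr_ge0// ltW// csq_gt0.
  have t0 : 0 < t by rewrite divr_gt0// exprn_gt0.
  (* If [t <= 1], then [t <= t^al] because [al <= 1]; otherwise [t^al >= 1] and the bound 6 is below
     48. *)
  have [t1|t1] := leP t 1.
    apply: le_trans h2 _; rewrite lerD2l ler_pM2l//.
    by apply: ger1_powR => //; rewrite t0.
  have : 1 <= t `^ al by rewrite -(powRr0 t) ler_powR ?ltW.
  by lra.
apply: (@bigO_of_le _ _ (`|C| * 49) (maxn 2 m0)) => n; rewrite geq_max => /andP[n2 mn].
have le_pow : n%:R `^ (- s - 1) <= n%:R `^ (- s - al) :> R.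
  by apply: ler_powR; [rewrite ler1n ltnW|lra].
have p0 := powR_ge0 (n%:R : R) (- s - al).
apply: le_trans (H n n2 mn) _.
apply: (@le_trans _ _ (`|C| * (n%:R `^ (- s - 1) + 48 * n%:R `^ (- s - al)))).
  by rewrite ler_wpM2r ?ler_norm// addr_ge0 ?mulr_ge0 ?powR_ge0.
by rewrite -mulrA ler_wpM2l//; lra.
Qed.

End Rates.

Theorem mainTheorem1 (R : realType) (s : R) (f : R -> R)
    (xC wC : forall n : nat, 'I_n -> R) (xG wG : forall n : nat, 'I_n -> R)
    (s_gt0 : 0 < s) (fX : class_X s f)
    (hC : forall n : nat, (2 <= n)%N -> clenshaw_curtis (xC n) (wC n))
    (hG : forall n : nat, (1 <= n)%N -> gauss (xG n) (wG n)) :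
  [/\ (fun n : nat => quad_error (xC n) (wC n) f) =O_\oo
        (fun n : nat => n%:R `^ (- s - 1)),
      2 <= s ->
      (fun n : nat => quad_error (xG n) (wG n) f) =O_\oo
        (fun n : nat => n%:R `^ (- s - 1))
    & s < 2 ->
      (fun n : nat => quad_error (xG n) (wG n) f) =O_\oo
        (fun n : nat => n%:R `^ (- (3 * s / 2)))].
Proof.
split=> [|s2|s2].
- exact: clenshaw_curtis_rate fX hC.
(* Here [al = 1], which is below [s]. *)
- by apply: gauss_rate => //; lra.
(* Here [al = s / 2], which is at most 1 because [s < 2]. *)
- have -> : - (3 * s / 2) = - s - s / 2 by field.
  by apply: gauss_rate => //; lra.
Qed.
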